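(* Let $n,p\ge 1$, let $f(\mathbf{x})=\sum_{i=1}^n f_i(\mathbf{x}_i)$ on $\mathbb{R}^{np}$ satisfy the strong convexity and smoothness assumption with constants $\mu>0$ and $L<\infty$, and let the time-varying undirected graph sequence $\{\mathcal{G}(k)\}_{k\ge 0}$ and the mixing matrix sequence $\{\mathbf{W}(k)\}_{k\ge 0}$ satisfy the mixing matrix assumption with positive integer $B$ (all as specified in the context). Let $$\delta \triangleq \sup_{k\ge B-1}\ \sigma_{\max}\Big\{\mathbf{W}_B(k)-\tfrac{1}{n}\mathbf{1}_n\mathbf{1}_n^T\Big\},\qquad \kappa\triangleq \frac{\mu}{L}.$$ Then, for any step-size $$c\in\Big(0,\ \frac{\mu\sqrt{\kappa}}{4B^2}(1-\delta)^2\Big],$$ the sequences $\{\mathbf{y}(k)\}$ and $\{\mathbf{x}(k)\}$ generated by the PANDA algorithm with step-size $c$ satisfy: $\{\mathbf{y}(k)\}$ converges to $\mathbf{y}^\star$, the unique solution of $$\min_{\mathbf{y}\in\mathbb{R}^{np}} f^*(\mathbf{y})\quad\text{s.t.}\quad \Big(\tfrac1n\mathbf{1}_n\mathbf{1}_n^T\otimes\mathbf{I}_p\Big)\mathbf{y}=\mathbf{0},$$ and $\{\mathbf{x}(k)\}$ converges to $\mathbf{x}^\star$, the unique solution of $$\min_{\mathbf{x}\in\mathbb{R}^{np}} f(\mathbf{x})\quad\text{s.t.}\quad \Big(\big(\mathbf{I}_n-\tfrac1n\mathbf{1}_n\mathbf{1}_n^T\big)\otimes\mathbf{I}_p\Big)\mathbf{x}=\mathbf{0},$$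 at a global R-linear rate $\mathcal{O}(\lambda^k)$, where $$\lambda=\begin{cases}\sqrt[2B]{1-\dfrac{c}{2L}} & \text{if } c\in(0,\alpha],\\[2mm] \sqrt[B]{\delta+\sqrt{\dfrac{4cB^2}{\mu\sqrt{\kappa}}}} & \text{if } c\in\Big(\alpha,\ \dfrac{\mu\sqrt{\kappa}}{4B^2}(1-\delta)^2\Big],\end{cases}$$ and $$\alpha\triangleq 2\sqrt{\kappa}\,\mu\left(\frac{\sqrt{(1-\delta^2)\kappa^{3/2}+8B^2}-\sqrt{8}\,\delta B}{\kappa^{3/2}+8B^2}\right)^2.$$
   Context: **Notation.** $\mathbf{1}_n\in\mathbb{R}^n$ is the all-ones vector, $\mathbf{I}_m$ the $m\times m$ identity, $\otimes$ the Kronecker product, $\sigma_{\max}(\cdot)$ the largest singular value, $\|\cdot\|$ the Euclidean norm. A vector $\mathbf{x}\in\mathbb{R}^{np}$ is partitioned as $\mathbf{x}=(\mathbf{x}_1^T,\dots,\mathbf{x}_n^T)^T$ with $\mathbf{x}_i\in\mathbb{R}^p$. The convex conjugate of $f$ is $f^*(\mathbf{y})=\sup_{\mathbf{x}\in\mathbb{R}^{np}}\{\mathbf{y}^T\mathbf{x}-f(\mathbf{x})\}$. A sequence $\{\mathbf{s}(k)\}$ converges to $\mathbf{s}^\star$ at a global R-linear rate $\mathcal{O}(\lambda^k)$ if there is a finite constant $C$ (which may depend on the initialization and the problem data, but not on $k$) with $\|\mathbf{s}(k)-\mathbf{s}^\star\|\le C\lambda^k$ for all $k\ge0$; ''global''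 means that this holds for every admissible initialization. **Objective assumption (strong convexity and smoothness).** $f(\mathbf{x})=\sum_{i=1}^n f_i(\mathbf{x}_i)$, with $f_i:\mathbb{R}^p\to\mathbb{R}$, is proper, closed, differentiable, and for all $\mathbf{x},\mathbf{y}\in\mathbb{R}^{np}$ $$f(\mathbf{x})\ge f(\mathbf{y})+\nabla f(\mathbf{y})^T(\mathbf{x}-\mathbf{y})+\tfrac{\mu}{2}\|\mathbf{x}-\mathbf{y}\|^2,\qquad \|\nabla f(\mathbf{x})-\nabla f(\mathbf{y})\|\le L\|\mathbf{x}-\mathbf{y}\|,$$ where $\mu>0$ and $L<\infty$. **Mixing matrix assumption.** $\mathcal{G}(k)=(\mathcal{V},\mathcal{E}(k))$, $k=0,1,\dots$, is a sequence of undirected graphs on the fixed vertex set $\mathcal{V}=\{1,\dots,n\}$. For every $k\ge0$, the matrix $\mathbf{W}(k)=(w_{ij}(k))\in\mathbb{R}^{n\times n}$ satisfies: 1. (Decentralized property) if $i\ne j$ and $(j,i)\notin\mathcal{E}(k)$, then $w_{ji}(k)=0$. 2. (Double stochasticity) $\mathbf{W}(k)$ has nonnegative entries, $\mathbf{W}(k)\mathbf{1}_n=\mathbf{1}_n$ and $\mathbf{1}_n^T\mathbf{W}(k)=\mathbf{1}_n^T$. 3. (Joint spectrum property) With $\mathbf{W}_b(k)\triangleq\mathbf{W}(k)\mathbf{W}(k-1)\cdots\mathbf{W}(k-b+1)$ for integers $b\ge1$ and $k\ge b-1$, there exists a positive integer $B$ such that $\sup_{k\ge B-1}\sigma_{\max}\{\mathbf{W}_B(k)-\frac1n\mathbf{1}_n\mathbf{1}_n^T\}<1$.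 The integer $B$ is fixed as in item 3. **PANDA algorithm with step-size $c>0$.** Initialize $\mathbf{z}(0)=\mathbf{x}(0)=\mathbf{0}\in\mathbb{R}^{np}$ and any $\mathbf{y}(0)\in\mathbb{R}^{np}$ with $(\frac1n\mathbf{1}_n\mathbf{1}_n^T\otimes\mathbf{I}_p)\mathbf{y}(0)=\mathbf{0}$. For $k=0,1,\dots$: $$\mathbf{x}(k+1)=\arg\min_{\mathbf{x}\in\mathbb{R}^{np}}\ f(\mathbf{x})-\mathbf{y}(k)^T\mathbf{x},$$ $$\mathbf{z}(k+1)=(\mathbf{W}(k)\otimes\mathbf{I}_p)\,\mathbf{z}(k)+\mathbf{x}(k+1)-\mathbf{x}(k),$$ $$\mathbf{y}(k+1)=\mathbf{y}(k)-c\,\big(\mathbf{x}(k+1)-\mathbf{z}(k+1)\big).$$ *)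

(* Defs.v *)
From mathcomp Require Export all_boot all_order all_algebra.
From mathcomp Require Export all_classical all_reals all_analysis.
From mathcomp Require Export mxtens.
Set Implicit Arguments.
Unset Strict Implicit.
Unset Printing Implicit Defensive.
Import Order.TTheory GRing.Theory Num.Theory.
Import numFieldNormedType.Exports.
Local Open Scope classical_set_scope.
Local Open Scope ring_scope.

Section Euclidean.
Context {R : realType} {m : nat}.
Implicit Types u v : 'cV[R]_m.

Definition dotv u v : R := (u^T *m v) ord0 ord0.

(* The library norm `|u| on matrices is the sup norm, hence this one. *)
Definition enorm u : R := Num.sqrt (dotv u u).

Definition grad (f : 'cV[R]_m -> R) u : 'cV[R]_m :=
  \col_i 'D_(delta_mx i ord0) f u.

(* Closedness in the sense of convex analysis; properness is automatic for
   real-valued f. *)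
Definition closed_fun (f : 'cV[R]_m -> R) : Prop :=
  closed [set xt : 'cV[R]_m * R | f xt.1 <= xt.2].

Definition strongly_convex_smooth (mu L : R) (f : 'cV[R]_m -> R) : Prop :=
  [/\ closed_fun f,
      forall u, differentiable f u,
      forall u v, f v + dotv (grad f v) (u - v) + mu / 2 * enorm (u - v) ^+ 2
                    <= f u
    & forall u v, enorm (grad f u - grad f v) <= L * enorm (u - v)].

Definition conjugate (f : 'cV[R]_m -> R) (y : 'cV[R]_m) : \bar R :=
  ereal_sup [set (dotv y u - f u)%:E | u in [set: 'cV[R]_m]].

End Euclidean.

Definition is_argmin {T : Type} {d : Order.disp_t} {O : porderType d}
    (g : T -> O) (D : set T) (a : T) : Prop :=
  D a /\ forall b, D b -> (g a <= g b)%O.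

Definition R_linear_rate {R : realType} {m : nat}
    (s : nat -> 'cV[R]_m) (l : 'cV[R]_m) (lambda : R) : Prop :=
  exists C : R, forall k : nat, enorm (s k - l) <= C * lambda ^+ k.

(* The singular values of A are the square roots of the eigenvalues of the
   positive semidefinite matrix A^T A; there are finitely many of them, and at
   least one when n > 0, so that the supremum is a maximum. *)
Definition sigma_max {R : realType} {m n : nat} (A : 'M[R]_(m, n)) : R :=
  sup [set Num.sqrt a | a in [set a | eigenvalue (A^T *m A) a]].

Section Network.
Context {R : realType} {n : nat}.

Definition ones : 'cV[R]_n := const_mx 1.
Definition avg_mx : 'M[R]_n := n%:R^-1 *: (ones *m ones^T).

Definition decentralized (E : rel 'I_n) (W : 'M[R]_n) : Prop :=
  forall i j : 'I_n, i != j -> ~~ E j i -> W j i = 0.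

Definition doubly_stochastic (W : 'M[R]_n) : Prop :=
  [/\ forall i j, 0 <= W i j, W *m ones = ones & ones^T *m W = ones^T].

(* W k *m W (k - 1) *m ... *m W (k - b + 1), used only for b.-1 <= k, where the
   subtractions are not truncated. *)
Definition window (W : nat -> 'M[R]_n) (b k : nat) : 'M[R]_n :=
  \big[mulmx/1%:M]_(0 <= j < b) W (k - j)%N.

(* For doubly stochastic W k the set below is bounded (by 1), so this real
   supremum is the genuine one. *)
Definition joint_spectrum (W : nat -> 'M[R]_n) (b : nat) : R :=
  sup [set sigma_max (window W b k - avg_mx) | k in [set k | (b.-1 <= k)%N]].

Definition mixing (E : nat -> rel 'I_n) (W : nat -> 'M[R]_n) (B : nat) : Prop :=
  [/\ forall k, symmetric (E k),
      forall k, decentralized (E k) (W k),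
      forall k, doubly_stochastic (W k),
      (0 < B)%N
    & joint_spectrum W B < 1].

End Network.

Section Panda.
Context {R : realType} {n p : nat}.

Definition block (x : 'cV[R]_(n * p)) (i : 'I_n) : 'cV[R]_p :=
  \col_j x (mxtens_index (i, j)) ord0.

Definition separable_sum (fi : 'I_n -> 'cV[R]_p -> R) (x : 'cV[R]_(n * p)) : R :=
  \sum_(i < n) fi i (block x i).

Definition zero_mean : set 'cV[R]_(n * p) :=
  [set y | (avg_mx *t (1%:M : 'M[R]_p)) *m y = 0].

Definition consensus : set 'cV[R]_(n * p) :=
  [set x | ((1%:M - avg_mx) *t (1%:M : 'M[R]_p)) *m x = 0].

Definition panda (f : 'cV[R]_(n * p) -> R) (W : nat -> 'M[R]_n) (c : R)
    (x y z : nat -> 'cV[R]_(n * p)) : Prop :=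
  [/\ x 0%N = 0, z 0%N = 0, zero_mean (y 0%N)
    & forall k : nat,
      [/\ is_argmin (fun u => f u - dotv (y k) u) setT (x k.+1),
          z k.+1 = (W k *t (1%:M : 'M[R]_p)) *m z k + x k.+1 - x k
        & y k.+1 = y k - c *: (x k.+1 - z k.+1)]].

End Panda.

Section Rates.
Context {R : realType}.
Implicit Types mu L delta c : R.

Definition step_max mu L (B : nat) delta : R :=
  mu * Num.sqrt (mu / L) / (4 * B%:R ^+ 2) * (1 - delta) ^+ 2.

Definition step_threshold mu L (B : nat) delta : R :=
  let kappa := mu / L in
  2 * Num.sqrt kappa * mu *
  ((Num.sqrt ((1 - delta ^+ 2) * kappa `^ (3 / 2) + 8 * B%:R ^+ 2)
      - Num.sqrt 8 * delta * B%:R)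
   / (kappa `^ (3 / 2) + 8 * B%:R ^+ 2)) ^+ 2.

(* For 0 < c <= step_max the bases of both powers are nonnegative, so that powR
   is the real root. *)
Definition panda_rate mu L (B : nat) delta c : R :=
  let kappa := mu / L in
  if c <= step_threshold mu L B delta
  then (1 - c / (2 * L)) `^ (2 * B)%:R^-1
  else (delta + Num.sqrt (4 * c * B%:R ^+ 2 / (mu * Num.sqrt kappa)))
         `^ B%:R^-1.

End Rates.

(* Main.v *)
Require Import Defs.
From mathcomp Require Import ring lra.
Set Implicit Arguments.
Unset Strict Implicit.
Unset Printing Implicit Defensive.
Import Order.TTheory GRing.Theory Num.Theory.
Import numFieldNormedType.Exports.
Local Open Scope classical_set_scope.
Local Open Scope ring_scope.

(** PANDA is gradient descent on the dual problem, minimizing the conjugate of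
    f over zero-mean vectors, with an inexact gradient: the dual gradient at y k
    is x (k+1), its projection to zero-mean vectors is x (k+1) minus its average,
    and z (k+1) is a running estimate of that average. The mean of z always
    equals that of x (panda_mean), so y stays zero-mean, and the error of a step
    is the centered part of z.

    The optimal pair is xs, the minimizer of f over consensus vectors, and
    grad f xs, which is zero-mean by first-order optimality. The dual
    suboptimality of y k is the Bregman divergence of f between xs and x (k+1);
    strong convexity and the Lipschitz bound compare it with the squares of
    both distances to the optimum, so that it is enough to make it decay like
    lambda^(2k).

    Two subsystems feed each other. The mixing matrices contract the centered
    part of z by delta over B steps, driven by the variations of x
    (center_z_window); this needs sigma_max to be an operator norm (sigma_maxP).
    In return, the dual descent inequality bounds the steps of y, hence the
    variations of x, by the centered part of z (gap_contract). After weighting by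
    lambda^(-k), the first subsystem has l2 gain at most
    B / (lambda^B - delta), and the second one at most a constant times c / mu.
    The rate is such that (lambda^B - delta)^2 >= 4 c B^2 / (mu sqrt kappa) and
    lambda^2 >= 1 - c / (2 L) (panda_rateP), and with c <= mu / 4 and kappa <= 1
    the product of the gains is below 1 (loop_gain_lt1). The small-gain argument
    (closed_loop_bounded) then bounds the weighted suboptimality. *)

(** * Euclidean geometry of column vectors *)

Section EuclideanTheory.
Context {R : realType} {m : nat}.
Implicit Types (u v w : 'cV[R]_m) (a t : R).

Lemma dotvE u v : dotv u v = \sum_i u i 0 * v i 0.
Proof. by rewrite /dotv !mxE; apply: eq_bigr => i _; rewrite !mxE. Qed.

Lemma dotvC u v : dotv u v = dotv v u.
Proof. by rewrite !dotvE; apply: eq_bigr => i _; rewrite mulrC. Qed.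

Lemma dotvDl u v w : dotv (u + v) w = dotv u w + dotv v w.
Proof. by rewrite /dotv linearD mulmxDl mxE. Qed.

Lemma dotvDr u v w : dotv w (u + v) = dotv w u + dotv w v.
Proof. by rewrite /dotv mulmxDr mxE. Qed.

Lemma dotvZl a u v : dotv (a *: u) v = a * dotv u v.
Proof. by rewrite /dotv linearZ -scalemxAl mxE. Qed.

Lemma dotvZr a u v : dotv u (a *: v) = a * dotv u v.
Proof. by rewrite /dotv -scalemxAr mxE. Qed.

Lemma dotvNl u v : dotv (- u) v = - dotv u v.
Proof. by rewrite -scaleN1r dotvZl mulN1r. Qed.

Lemma dotvNr u v : dotv u (- v) = - dotv u v.
Proof. by rewrite -scaleN1r dotvZr mulN1r. Qed.

Lemma dotv0l v : dotv 0 v = 0.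
Proof. by rewrite -(scale0r 0) dotvZl mul0r. Qed.

Lemma dotv0r v : dotv v 0 = 0.
Proof. by rewrite dotvC dotv0l. Qed.

Definition dotv_lin :=
  (dotvDl, dotvDr, dotvZl, dotvZr, dotvNl, dotvNr, dotv0l, dotv0r).

Lemma dotv_subC u v : dotv (u - v) (u - v) = dotv (v - u) (v - u).
Proof. by rewrite !dotv_lin; ring. Qed.

Lemma dotv_ge0 u : 0 <= dotv u u.
Proof. by rewrite dotvE sumr_ge0 // => i _; rewrite -expr2 sqr_ge0. Qed.

Lemma dotv_eq0 u : dotv u u <= 0 -> u = 0.
Proof.
move=> u0; apply/colP => i; rewrite mxE; apply/eqP; rewrite -sqrf_eq0.
rewrite eq_le sqr_ge0 andbT (le_trans _ u0) // dotvE (bigD1 i) //= -expr2.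
by rewrite lerDl sumr_ge0 // => j _; rewrite -expr2 sqr_ge0.
Qed.

Lemma dotv_subl0 u v : (forall w, dotv (u - v) w <= 0) -> u = v.
Proof. by move=> /(_ (u - v)) /dotv_eq0 /eqP; rewrite subr_eq0 => /eqP. Qed.

Lemma enorm_ge0 u : 0 <= enorm u.
Proof. exact: sqrtr_ge0. Qed.

Lemma enorm_sqr u : enorm u ^+ 2 = dotv u u.
Proof. by rewrite sqr_sqrtr // dotv_ge0. Qed.

Lemma enorm0 : enorm (0 : 'cV[R]_m) = 0.
Proof. by rewrite /enorm dotv0l sqrtr0. Qed.

Lemma enorm_leP u a : 0 <= a -> (enorm u <= a) = (dotv u u <= a ^+ 2).
Proof.
by move=> a0; rewrite -enorm_sqr ler_pXn2r // nnegrE enorm_ge0.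
Qed.

Lemma enorm_le_dotv u v : dotv u u <= dotv v v -> enorm u <= enorm v.
Proof. by move=> uv; rewrite enorm_leP ?enorm_ge0 // enorm_sqr. Qed.

Lemma enormZ a u : enorm (a *: u) = `|a| * enorm u.
Proof.
by rewrite /enorm !dotv_lin mulrA -expr2 sqrtrM ?sqr_ge0 // sqrtr_sqr.
Qed.

(** The form of Cauchy-Schwarz in which the weight t trades one norm against
    the other; it is the expansion of 0 <= |2 t u - v|^2. Duality of the two
    quadratic bounds on a convex function is exactly this inequality with
    t = 1 / (2 mu) or t = 1 / (4 L). *)
Lemma young u v t : 0 < t -> dotv u v <= t * dotv u u + dotv v v / (4 * t).
Proof.
move=> t0; have := dotv_ge0 ((2 * t) *: u - v).
rewrite !dotv_lin (dotvC v u) => h.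
rewrite -(ler_pM2l (_ : 0 < 4 * t)); last by rewrite mulr_gt0.
have -> : 4 * t * (t * dotv u u + dotv v v / (4 * t)) =
   4 * t * t * dotv u u + dotv v v by field; rewrite gt_eqF.
lra.
Qed.

Lemma cauchy_schwarz u v : dotv u v <= enorm u * enorm v.
Proof.
have [v0|v0] := ltP 0 (enorm v); last first.
  have -> : v = 0.
    by apply: dotv_eq0; rewrite -enorm_sqr exprn_even_le0 //= eq_le v0 enorm_ge0.
  by rewrite dotv0r enorm0 mulr0.
have [u0|u0] := ltP 0 (enorm u); last first.
  have -> : u = 0.
    by apply: dotv_eq0; rewrite -enorm_sqr exprn_even_le0 //= eq_le u0 enorm_ge0.
  by rewrite dotv0l enorm0 mul0r.
apply: le_trans (young u v (_ : 0 < enorm v / (2 * enorm u))) _.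
  by rewrite divr_gt0 // mulr_gt0.
rewrite -!enorm_sqr le_eqVlt; apply/orP; left; apply/eqP.
by field; rewrite !gt_eqF.
Qed.

Lemma enormD u v : enorm (u + v) <= enorm u + enorm v.
Proof.
rewrite enorm_leP ?addr_ge0 ?enorm_ge0 // !dotv_lin (dotvC v u).
by have := cauchy_schwarz u v; rewrite -!enorm_sqr; nra.
Qed.


Lemma coord_le_enorm u i : `|u i 0| <= enorm u.
Proof.
rewrite -(ler_pXn2r (n := 2)) ?nnegrE ?enorm_ge0 // enorm_sqr.
rewrite real_normK ?num_real // dotvE (bigD1 i) //= -expr2 lerDl sumr_ge0 //.
by move=> j _; rewrite -expr2 sqr_ge0.
Qed.

End EuclideanTheory.

(** * Strongly convex functions with Lipschitz gradient *)

(** When g is the gradient of f this is the Bregman divergence of f. With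
    v minimizing f - <y, .>, i.e. y = g v, it is also a divergence of the
    conjugate of f, which is how dual quantities are handled here without
    differentiating the conjugate. *)
Definition bregman {R : realType} {m : nat} (f : 'cV[R]_m -> R)
  (g : 'cV[R]_m -> 'cV[R]_m) (u v : 'cV[R]_m) : R :=
  f u - f v - dotv (g v) (u - v).

Section ConvexTheory.
Context {R : realType} {m : nat}.
Context {f : 'cV[R]_m -> R} {g : 'cV[R]_m -> 'cV[R]_m} {mu L : R}.
Context (mu_gt0 : 0 < mu).
Context (f_convex : forall u v,
  f v + dotv (g v) (u - v) + mu / 2 * enorm (u - v) ^+ 2 <= f u).
Context (g_lip : forall u v, enorm (g u - g v) <= L * enorm (u - v)).

Lemma bregman_ge_primal u v : mu / 2 * dotv (u - v) (u - v) <= bregman f g u v.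
Proof. by have := f_convex u v; rewrite /bregman enorm_sqr; lra. Qed.

Lemma bregman_ge0 u v : 0 <= bregman f g u v.
Proof.
apply: le_trans (bregman_ge_primal u v).
by rewrite mulr_ge0 ?dotv_ge0 ?divr_ge0 // ltW.
Qed.

Lemma bregman_sym u v :
  bregman f g u v + bregman f g v u = dotv (g u - g v) (u - v).
Proof. by rewrite /bregman !dotv_lin; lra. Qed.

(** This is the 1/mu-smoothness of the conjugate. The symmetrized divergence is
    <g u - g v, u - v>; strong convexity takes mu/2 |u - v|^2 away from it, and
    Young's inequality bounds what is left. *)
Lemma bregman_le_dual u v :
  bregman f g u v <= dotv (g u - g v) (g u - g v) / (2 * mu).
Proof.
have := bregman_ge_primal v u; have := bregman_sym u v.
have t0 : 0 < (2 * mu)^-1 by rewrite invr_gt0 mulr_gt0.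
have := young (g u - g v) (u - v) t0.
have -> : dotv (u - v) (u - v) / (4 / (2 * mu)) =
  mu / 2 * dotv (u - v) (u - v) by field; rewrite gt_eqF.
by rewrite (dotv_subC v u) [_ / (2 * mu)]mulrC; lra.
Qed.

Lemma grad_strong_mono u v :
  mu * dotv (u - v) (u - v) <= dotv (g u - g v) (u - v).
Proof.
rewrite -bregman_sym; have := bregman_ge_primal u v.
have := bregman_ge_primal v u.
rewrite (dotv_subC v u); lra.
Qed.

Lemma enorm_le_grad u v : mu * enorm (u - v) <= enorm (g u - g v).
Proof.
have [h|h] := ltP 0 (enorm (u - v)); last first.
  by apply: le_trans (enorm_ge0 _); rewrite pmulr_rle0.
rewrite -(ler_pM2r h) -mulrA -expr2 enorm_sqr.
exact: le_trans (grad_strong_mono u v) (cauchy_schwarz _ _).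
Qed.

Lemma mu_le_L : (0 < m)%N -> mu <= L.
Proof.
move=> m0; pose u : 'cV[R]_m := const_mx 1.
have u0 : 0 < enorm (u - 0).
  rewrite subr0 lt_def enorm_ge0 andbT; apply/negP => /eqP h.
  have : u = 0 by apply: dotv_eq0; rewrite -enorm_sqr h expr0n.
  by move=> /colP /(_ (Ordinal m0)) /eqP; rewrite !mxE oner_eq0.
rewrite -(ler_pM2r u0).
exact: le_trans (enorm_le_grad _ _) (g_lip _ _).
Qed.

Context (L_gt0 : 0 < L).

(** Convexity bounds f u - f v by <g u, u - v>, and the Lipschitz bound
    then replaces g u by g v. Integrating the gradient along the segment would
    give L/2 instead of L, a precision for which the rate has no use. *)
Lemma bregman_le_primal u v : bregman f g u v <= L * dotv (u - v) (u - v).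
Proof.
have := bregman_ge0 v u; have := bregman_sym u v.
have := cauchy_schwarz (g u - g v) (u - v); have := g_lip u v.
have := enorm_ge0 (u - v); rewrite -enorm_sqr; nra.
Qed.

(** Strong convexity of the conjugate. A gradient step of length 1/(2L) from u,
    taken for the convex function f - <g v, .>, cannot go below its minimum,
    which is attained at v; hence the decrease that the step guarantees bounds
    the divergence from below. *)
Lemma bregman_ge_dual u v :
  dotv (g u - g v) (g u - g v) / (4 * L) <= bregman f g u v.
Proof.
pose q := u - (2 * L)^-1 *: (g u - g v).
have := bregman_ge0 q v; have := bregman_le_primal q u.
have -> : q - u = - ((2 * L)^-1 *: (g u - g v)).
  by rewrite /q addrAC subrr add0r.
set G := g u - g v.
have -> : bregman f g q v = bregman f g q u + bregman f g u v - (2 * L)^-1 * dotv G G.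
  rewrite /bregman /q -/G.
  set t := (2 * L)^-1; rewrite /G !dotv_lin; ring.
rewrite dotvNl dotvNr opprK dotvZl dotvZr.
have -> : dotv G G / (4 * L) = (2 * L)^-1 * dotv G G / 2.
  by field; rewrite gt_eqF.
have -> : L * ((2 * L)^-1 * ((2 * L)^-1 * dotv G G)) =
   (2 * L)^-1 * dotv G G / 2.
  by field; rewrite gt_eqF.
lra.
Qed.

(** The directional first-order condition, from the quadratic upper bound only:
    with K = L |v|^2, moving by t along v costs at most t^2 K, so that t can be
    taken of order e / (K + 1) to get the inequality up to e. *)
Lemma argmin_first_order x y v :
  (forall t, 0 < t -> f x - dotv y x <= f (x + t *: v) - dotv y (x + t *: v)) ->
  dotv y v <= dotv (g x) v.
Proof.
move=> xmin; rewrite -subr_le0; apply/ler_addgt0Pr => e e0; rewrite add0r.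
pose K := L * dotv v v.
have K0 : 0 <= K by rewrite mulr_ge0 ?dotv_ge0 ?ltW.
have t0 : 0 < e / (K + 1) by rewrite divr_gt0 // ltr_wpDl.
have := xmin _ t0; have := bregman_le_primal (x + (e / (K + 1)) *: v) x.
set t := e / (K + 1) in t0 *.
rewrite /bregman (addrAC x) subrr add0r !dotv_lin -/K => h1 h2.
have : t * (dotv y v - dotv (g x) v) <= t * (t * K) by rewrite /K; lra.
rewrite ler_pM2l // => h; apply: (le_trans h).
rewrite /t mulrAC ler_pdivrMr ?ltr_wpDl // mulrDr mulr1 lerDl.
exact: ltW.
Qed.

Lemma argmin_grad x y :
  (forall u, f x - dotv y x <= f u - dotv y u) -> y = g x.
Proof.
move=> xmin; apply: dotv_subl0 => w; rewrite !dotv_lin subr_le0.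
by apply: argmin_first_order => t _; exact: xmin.
Qed.

End ConvexTheory.

(** * The largest singular value as an operator norm *)

Section SigmaMaxTopology.
Context {R : realType}.

Lemma norm_rV_le k (v : 'rV[R]_k) (a : R) :
  0 <= a -> (forall j, `|v 0 j| <= a) -> `|v| <= a.
Proof.
move=> a0 h; rewrite [leLHS]/Num.norm /= mx_normrE.
by apply/bigmax_leP; split=> [//|[i j] _ /=]; rewrite ord1.
Qed.

Lemma continuous_addR : continuous (fun z : R * R => z.1 + z.2).
Proof. by move=> z; apply: cvgD; [exact: cvg_fst|exact: cvg_snd]. Qed.

Lemma continuous_dotv_mul_tr m n (A : 'M[R]_(m, n)) :
  continuous (fun v : 'rV[R]_n => dotv (A *m v^T) (A *m v^T)).
Proof.
rewrite (_ : (fun _ => _) = fun v : 'rV[R]_n =>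
    \sum_(i < m) (\sum_(j < n) A i j * v 0 j) * (\sum_(j < n) A i j * v 0 j)).
  apply: continuous_big => [|i _ v]; first exact: continuous_addR.
  have h : continuous (fun v : 'rV[R]_n => \sum_(j < n) A i j * v 0 j).
    apply: continuous_big => [|j _ w]; first exact: continuous_addR.
    apply: (@cvgM R _ _ _ (fun=> A i j) _ _ _ _ (@coord_continuous R 1 n 0 j w)).
    exact: cvg_cst.
  exact: (cvgM (h v) (h v)).
apply/funext => w; rewrite dotvE; apply: eq_bigr => i _.
by rewrite !mxE; congr (_ * _); apply: eq_bigr => j _; rewrite mxE.
Qed.

Lemma compact_sphere n : compact [set v : 'rV[R]_n | dotv v^T v^T = 1].
Proof.
apply: bounded_closed_compact.
  exists 1; split=> [|a a1 v /= v1]; first exact: num_real.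
  apply: norm_rV_le => [|j]; first by rewrite (le_trans ler01) // ltW.
  have := coord_le_enorm v^T j; rewrite mxE => /le_trans; apply.
  by rewrite /enorm v1 sqrtr1 ltW.
have := @continuous_dotv_mul_tr n n 1%:M.
move=> /continuous_closedP /(_ _ (@closed_eq R 1)); congr (closed _).
by apply/seteqP; split=> v /=; rewrite mul1mx.
Qed.

End SigmaMaxTopology.

Section SigmaMax.
Context {R : realType} {m n : nat}.
Implicit Types (A : 'M[R]_(m, n)) (u : 'cV[R]_n).

Lemma dotv_mul_tr A u w : dotv (A *m u) (A *m w) = dotv u (A^T *m A *m w).
Proof. by rewrite /dotv trmx_mul !mulmxA. Qed.

(** A maximizer c of |A v|^2 on the unit sphere exists by compactness, and the
    maximum M makes M - A^T A positive semidefinite with c isotropic. Moving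
    from c along w = (M - A^T A) c then shows w = 0, so that M is an
    eigenvalue. *)
Lemma rayleigh A : (0 < n)%N ->
  exists2 M, eigenvalue (A^T *m A) M
    & forall u, dotv (A *m u) (A *m u) <= M * dotv u u.
Proof.
move=> n0.
have [||c] := @EVT_max_rV R n (fun v => dotv (A *m v^T) (A *m v^T))
  [set v | dotv v^T v^T = 1] _ (@compact_sphere R n).
- exists (delta_mx 0 (Ordinal n0)); rewrite /= dotvE (bigD1 (Ordinal n0)) //=.
  rewrite !mxE !eqxx mulr1 big1 ?addr0 // => i /negPf i0.
  by rewrite !mxE i0 mul0r.
- exact/continuous_subspaceT/continuous_dotv_mul_tr.
rewrite inE /= => c1 cmax.
set M := dotv _ _ in cmax.
have M0 : 0 <= M by exact: dotv_ge0.
have hM u : dotv (A *m u) (A *m u) <= M * dotv u u.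
  have [u0|u0] := ltP 0 (dotv u u); last first.
    by rewrite (dotv_eq0 u0) mulmx0 !dotv0l mulr0.
  have e0 : 0 < enorm u by rewrite sqrtr_gt0.
  have := cmax ((enorm u)^-1 *: u^T).
  rewrite inE /= linearZ /= trmxK -scalemxAr !dotv_lin -enorm_sqr => h.
  rewrite -ler_pdivrMr ?exprn_gt0 //.
  apply: le_trans (h _); last by field; rewrite gt_eqF.
  by rewrite le_eqVlt; apply/orP; left; apply/eqP; field; rewrite gt_eqF.
exists M => //.
pose S := A^T *m A.
(* w is kept opaque, lest rewriting bilinearly also expand it *)
have [w wE] : exists w, w = M *: c^T - S *m c^T by eexists.
have w0 : w = 0.
  apply: dotv_eq0.
  have := hM (c^T - (M + 1)^-1 *: w); have := hM w.
  have -> : A *m (c^T - (M + 1)^-1 *: w) = A *m c^T - (M + 1)^-1 *: (A *m w).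
    by rewrite mulmxBr -scalemxAr.
  have hw : dotv (A *m w) (A *m c^T) = M * dotv w c^T - dotv w w.
    by rewrite dotv_mul_tr -/S {4}wE dotvDr dotvNr dotvZr; ring.
  rewrite !dotv_lin -/M (dotvC (A *m c^T) _) hw (dotvC c^T w) c1.
  set N := dotv w w; set Q := dotv (A *m w) _ => hQ.
  have M1 : 0 < M + 1 by rewrite ltr_wpDl.
  rewrite -(ler_pM2l (_ : 0 < (M + 1) ^+ 2)) ?exprn_gt0 //.
  rewrite [leLHS](_ : _ = (M + 1) ^+ 2 * M - 2 * (M + 1) * (M * dotv w c^T - N) + Q);
    last by field; rewrite gt_eqF.
  rewrite [leRHS](_ : _ = (M + 1) ^+ 2 * M - 2 * (M + 1) * (M * dotv w c^T) + M * N);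
    last by field; rewrite gt_eqF.
  have := dotv_ge0 (A *m w); rewrite -/Q => Q0 h.
  have : (M + 1) * (2 * N) <= M * N by lra.
  have := dotv_ge0 w; rewrite -/N; nra.
apply/eigenvalueP; exists c; last first.
  by apply/eqP => c0; move: c1; rewrite c0 trmx0 dotv0l => /eqP; rewrite eq_sym oner_eq0.
apply: trmx_inj; rewrite linearZ /= trmx_mul trmx_mul trmxK.
by apply/esym/eqP; rewrite -subr_eq0 -/S -wE w0.
Qed.

Lemma sigma_set_le A M a :
  (forall u, dotv (A *m u) (A *m u) <= M ^+ 2 * dotv u u) -> 0 <= M ->
  eigenvalue (A^T *m A) a -> Num.sqrt a <= M.
Proof.
move=> hM M0 /eigenvalueP[v va v0].
have v1 : 0 < dotv v^T v^T.
  rewrite lt_def dotv_ge0 andbT; apply: contra v0 => /eqP h.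
  by rewrite -(trmxK v) (dotv_eq0 (u := v^T)) ?h // trmx0.
have := hM v^T; rewrite dotv_mul_tr.
have -> : A^T *m A *m v^T = a *: v^T.
  by apply: trmx_inj; rewrite !trmx_mul !trmxK va linearZ /= trmxK.
rewrite dotvZr ler_pM2r // => aM.
by rewrite -[leRHS](ger0_norm M0) -sqrtr_sqr ler_wsqrtr.
Qed.

Lemma sigma_max_le A M : (0 < n)%N -> 0 <= M ->
  (forall u, dotv (A *m u) (A *m u) <= M ^+ 2 * dotv u u) -> sigma_max A <= M.
Proof.
move=> n0 M0 hM; apply: ge_sup.
  by have [a ha _] := rayleigh A n0; exists (Num.sqrt a), a.
by move=> _ [a ha <-]; exact: sigma_set_le ha.
Qed.

(** sigma_max is the supremum of square roots of eigenvalues; Rayleigh's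
    maximizer identifies it with the operator norm. The case M < 0 cannot occur,
    but has to be excluded since Num.sqrt is 0 there. *)
Lemma sigma_maxP A u : (0 < n)%N ->
  0 <= sigma_max A /\ dotv (A *m u) (A *m u) <= sigma_max A ^+ 2 * dotv u u.
Proof.
move=> n0; have [M hM h] := rayleigh A n0.
have hub : Num.sqrt M <= sigma_max A.
  apply: ub_le_sup; last by exists M.
  exists (Num.sqrt M) => _ [a ha <-].
  apply: sigma_set_le ha => [w|]; last exact: sqrtr_ge0.
  rewrite sqr_sqrtr //.
  have [//|M0] := leP 0 M.
  have := le_trans (dotv_ge0 _) (h (const_mx 1)).
  rewrite nmulr_rge0 // => /dotv_eq0 /colP /(_ (Ordinal n0)).
  by rewrite !mxE => /eqP; rewrite oner_eq0.
split; first exact: le_trans (sqrtr_ge0 _) hub.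
apply: le_trans (h u) _; rewrite ler_wpM2r ?dotv_ge0 //.
have [M0|/ltW M0] := leP 0 M; last by rewrite (le_trans M0) ?sqr_ge0.
rewrite -{1}(sqr_sqrtr M0) ler_pXn2r // nnegrE ?sqrtr_ge0 //.
exact: le_trans (sqrtr_ge0 _) hub.
Qed.

End SigmaMax.

(** * Doubly stochastic matrices and the averaging projection *)

Section Mixing.
Context {R : realType} {n : nat}.
Implicit Types (W A : 'M[R]_n) (u : 'cV[R]_n).

Definition nonexpansive A := forall u, dotv (A *m u) (A *m u) <= dotv u u.

Lemma nonexpansive1 : nonexpansive 1%:M.
Proof. by move=> u; rewrite mul1mx. Qed.

Lemma nonexpansiveM A W :
  nonexpansive A -> nonexpansive W -> nonexpansive (A *m W).
Proof. by move=> hA hW u; rewrite -mulmxA (le_trans (hA _)). Qed.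

Lemma jensen_sqr (w x : 'I_n -> R) : (forall i, 0 <= w i) -> \sum_i w i = 1 ->
  (\sum_i w i * x i) ^+ 2 <= \sum_i w i * x i ^+ 2.
Proof.
move=> w0 w1; set s := \sum_i _ * x _.
have : 0 <= \sum_i w i * (x i - s) ^+ 2.
  by apply: sumr_ge0 => i _; rewrite mulr_ge0 ?sqr_ge0.
rewrite (eq_bigr (fun i => w i * x i ^+ 2 - 2 * s * (w i * x i) + s ^+ 2 * w i));
  last by move=> i _; ring.
rewrite big_split sumrB /= -!mulr_sumr w1 -/s; lra.
Qed.

(** Rows that sum to 1 allow Jensen's inequality in each entry of W u, and
    columns that sum to 1 make the resulting bounds add up to |u|^2. *)
Lemma doubly_stochastic_nonexpansive W : doubly_stochastic W -> nonexpansive W.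
Proof.
move=> [W0 W1 W1T] u; rewrite !dotvE.
have rowsum i : \sum_j W i j = 1.
  move/colP: W1 => /(_ i); rewrite !mxE => <-.
  by apply: eq_bigr => j _; rewrite mxE mulr1.
have colsum j : \sum_i W i j = 1.
  move/rowP: W1T => /(_ j); rewrite !mxE => <-.
  by apply: eq_bigr => i _; rewrite !mxE mul1r.
apply: (@le_trans _ _ (\sum_i \sum_j W i j * u j 0 ^+ 2)).
  by apply: ler_sum => i _; rewrite -expr2 mxE jensen_sqr.
rewrite exchange_big /=; apply: ler_sum => j _.
by rewrite -mulr_suml colsum mul1r expr2.
Qed.

Lemma avg_mul W : doubly_stochastic W -> avg_mx *m W = avg_mx.
Proof. by case=> _ _ h; rewrite /avg_mx -scalemxAl -mulmxA h. Qed.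

Lemma mul_avg W : doubly_stochastic W -> W *m avg_mx = avg_mx.
Proof. by case=> _ h _; rewrite /avg_mx -scalemxAr mulmxA h. Qed.

Lemma trmx_avg : (avg_mx : 'M[R]_n)^T = avg_mx.
Proof. by rewrite /avg_mx linearZ /= trmx_mul trmxK. Qed.

Context (n_gt0 : (0 < n)%N).

Lemma avg_doubly_stochastic : doubly_stochastic (avg_mx : 'M[R]_n).
Proof.
have n0 : n%:R != 0 :> R by rewrite pnatr_eq0 -lt0n.
have o1 : (ones : 'cV[R]_n)^T *m ones = n%:R%:M.
  apply/matrixP => i j; rewrite !ord1 !mxE mulr1n.
  under eq_bigr do rewrite !mxE mulr1.
  by rewrite sumr_const card_ord.
split=> [i j||].
- rewrite !mxE mulr_ge0 ?invr_ge0 ?ler0n //.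
  by apply: sumr_ge0 => k _; rewrite !mxE mulr1.
- rewrite /avg_mx -scalemxAl -mulmxA o1 mul_mx_scalar scalerA mulVf //.
  by rewrite scale1r.
- rewrite /avg_mx -scalemxAr mulmxA o1 mul_scalar_mx scalerA mulVf //.
  by rewrite scale1r.
Qed.

Lemma avg_idem : (avg_mx : 'M[R]_n) *m avg_mx = avg_mx.
Proof. exact: avg_mul avg_doubly_stochastic. Qed.

Lemma center_nonexpansive : nonexpansive (1%:M - avg_mx).
Proof.
move=> u; rewrite mulmxBl mul1mx !dotv_lin.
have -> : dotv (avg_mx *m u) u = dotv (avg_mx *m u) (avg_mx *m u).
  by rewrite dotv_mul_tr trmx_avg avg_idem dotvC.
rewrite dotvC; have := dotv_ge0 (avg_mx *m u).
have -> : dotv (avg_mx *m u) u = dotv (avg_mx *m u) (avg_mx *m u).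
  by rewrite dotv_mul_tr trmx_avg avg_idem dotvC.
lra.
Qed.

Context {W : nat -> 'M[R]_n} (W_ds : forall k, doubly_stochastic (W k)).

Lemma window0 k : window W 0 k = 1%:M.
Proof. by rewrite /window big_nil. Qed.

(** Truncated subtraction satisfies k - j.+1 = k.-1 - j also when k = 0, hence
    the recursion for all b and k. *)
Lemma windowS b k : window W b.+1 k = W k *m window W b k.-1.
Proof.
rewrite /window big_nat_recl // subn0; congr (_ *m _).
by apply: eq_bigr => j _; rewrite -subn1 -subnDA add1n.
Qed.

Lemma window_nonexpansive b k : nonexpansive (window W b k).
Proof.
elim: b k => [|b IH] k; first by rewrite window0; exact: nonexpansive1.
rewrite windowS; apply: nonexpansiveM => //.
exact: doubly_stochastic_nonexpansive.
Qed.

Lemma window_avg b k : window W b k *m avg_mx = avg_mx.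
Proof.
elim: b k => [|b IH] k; first by rewrite window0 mul1mx.
by rewrite windowS -mulmxA IH mul_avg.
Qed.

Lemma sigma_max_window b k : sigma_max (window W b k - avg_mx) <= 1.
Proof.
apply: sigma_max_le => // u; rewrite expr1n mul1r.
have -> : window W b k - avg_mx = window W b k *m (1%:M - avg_mx).
  by rewrite mulmxBr mulmx1 window_avg.
apply: nonexpansiveM; [exact: window_nonexpansive|exact: center_nonexpansive].
Qed.

Lemma sigma_max_joint b k : (b.-1 <= k)%N ->
  sigma_max (window W b k - avg_mx) <= joint_spectrum W b.
Proof.
move=> bk; apply: ub_le_sup; last by exists k.
by exists 1 => _ [j _ <-]; exact: sigma_max_window.
Qed.

Lemma joint_spectrum_ge0 b : 0 <= joint_spectrum W b.
Proof.
apply: le_trans (sigma_max_joint (leqnn _)).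
by have [] := sigma_maxP (window W b b.-1 - avg_mx) 0 n_gt0.
Qed.

(** On zero-mean vectors the averaging matrix can be subtracted for free, which
    turns the spectral assumption into a contraction by delta. *)
Lemma window_contract b k u : (b.-1 <= k)%N -> avg_mx *m u = 0 ->
  dotv (window W b k *m u) (window W b k *m u)
    <= joint_spectrum W b ^+ 2 * dotv u u.
Proof.
move=> bk u0; have [s0 h] := sigma_maxP (window W b k - avg_mx) u n_gt0.
move: h; rewrite mulmxBl u0 subr0 => /le_trans; apply.
rewrite ler_wpM2r ?dotv_ge0 // ler_pXn2r ?nnegrE ?joint_spectrum_ge0 //.
exact: sigma_max_joint.
Qed.

End Mixing.

(** * The small-gain argument in square-summable norms *)

Section SmallGain.
Context {R : realType}.
Implicit Types (a b d F : nat -> R) (B : nat) (rho delta : R).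

Definition sumsq a N := \sum_(k < N) a k ^+ 2.

Lemma sumsqS a N : sumsq a N.+1 = sumsq a N + a N ^+ 2.
Proof. exact: big_ord_recr. Qed.

Lemma sumsq_ge0 a N : 0 <= sumsq a N.
Proof. by apply: sumr_ge0 => i _; rewrite sqr_ge0. Qed.

Lemma sumsqD a M N : sumsq a (M + N) = sumsq a M + \sum_(k < N) a (M + k)%N ^+ 2.
Proof. by rewrite /sumsq big_split_ord. Qed.

Lemma sumsq_mono a M N : (M <= N)%N -> sumsq a M <= sumsq a N.
Proof.
by move=> /subnKC <-; rewrite sumsqD lerDl sumr_ge0 // => i _; rewrite sqr_ge0.
Qed.

Lemma sqr_sum_le B (x : 'I_B -> R) : (0 < B)%N ->
  (\sum_i x i) ^+ 2 <= B%:R * \sum_i x i ^+ 2.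
Proof.
move=> B0; have B1 : 0 < B%:R :> R by rewrite ltr0n.
have w0 (i : 'I_B) : 0 <= B%:R^-1 :> R by rewrite invr_ge0 ltW.
have w1 : \sum_(i < B) B%:R^-1 = 1 :> R.
  by rewrite sumr_const card_ord -[LHS]mulr_natl mulfV // gt_eqF.
have := jensen_sqr x w0 w1; rewrite -!mulr_sumr exprMn.
rewrite -(ler_pM2l (_ : 0 < B%:R ^+ 2)) ?exprn_gt0 // mulrA -exprMn.
rewrite mulfV ?gt_eqF // expr1n mul1r => /le_trans; apply.
by rewrite le_eqVlt; apply/orP; left; apply/eqP; field; rewrite gt_eqF.
Qed.

(** A B-step recursion with contraction delta/rho and input b has gain
    B / (rho - delta) from b to a in the l2 norm. Convexity of the square gives
    (delta a + s)^2 <= rho (delta a^2 + s^2 / (rho - delta)), which sums over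
    time without loss. One factor B is Cauchy-Schwarz on the B inputs of a
    window, the other one counts the windows that contain a given input. *)
Lemma window_gain B rho delta a b : (0 < B)%N -> 0 <= delta -> delta < rho ->
  (forall k, 0 <= a k) ->
  (forall k, rho * a (k + B)%N <= delta * a k + \sum_(t < B) b (k + t.+1)%N) ->
  forall N, (rho - delta) ^+ 2 * sumsq a (B + N) <=
    (rho - delta) * rho * sumsq a B + B%:R ^+ 2 * sumsq b (B + N).
Proof.
move=> B0 d0 dr a0 step N.
have e0 : 0 < rho - delta by rewrite subr_gt0.
have r0 : 0 < rho by exact: le_lt_trans d0 dr.
have ptwise k : (rho - delta) * rho * a (B + k)%N ^+ 2 <=
    (rho - delta) * delta * a k ^+ 2
    + B%:R * \sum_(t < B) b (k + t.+1)%N ^+ 2.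
  have := step k; rewrite addnC; set s := \sum_(t < B) _ => hs.
  have : s ^+ 2 <= B%:R * \sum_(t < B) b (k + t.+1)%N ^+ 2 by exact: sqr_sum_le.
  set Q := _ * \sum_(t < B) _ => sQ.
  have h1 : (rho * a (B + k)%N) ^+ 2 <= (delta * a k + s) ^+ 2.
    rewrite ler_pXn2r // nnegrE; first by rewrite mulr_ge0 // ltW.
    by apply: le_trans hs; rewrite mulr_ge0 // ltW.
  have h2 : (rho - delta) * (delta * a k + s) ^+ 2 <=
      rho * ((rho - delta) * delta * a k ^+ 2 + s ^+ 2).
    rewrite -subr_ge0 (_ : _ - _ = delta * ((rho - delta) * a k - s) ^+ 2);
      last by ring.
    by rewrite mulr_ge0 ?sqr_ge0.
  rewrite -(ler_pM2l r0) mulrDr.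
  have := ler_wpM2l (ltW e0) h1; have := ler_wpM2l (ltW r0) sQ.
  lra.
have sumb (t : 'I_B) : \sum_(k < N) b (k + t.+1)%N ^+ 2 <= sumsq b (B + N).
  apply: (@le_trans _ _ (sumsq b (t.+1 + N))); last first.
    by apply: sumsq_mono; rewrite leq_add2r.
  rewrite sumsqD -[leLHS]add0r lerD ?sumsq_ge0 // le_eqVlt; apply/orP; left.
  by apply/eqP/eq_bigr => i _; rewrite addnC.
have total : \sum_(k < N) ((rho - delta) * rho * a (B + k)%N ^+ 2) <=
    \sum_(k < N) ((rho - delta) * delta * a k ^+ 2
    + B%:R * \sum_(t < B) b (k + t.+1)%N ^+ 2) by apply: ler_sum.
move: total; rewrite big_split /= -!mulr_sumr exchange_big /= -/(sumsq a N).
have : \sum_(t < B) \sum_(k < N) b (k + t.+1)%N ^+ 2 <= B%:R * sumsq b (B + N).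
  apply: le_trans (ler_sum _ (fun t _ => sumb t)) _.
  by rewrite sumr_const card_ord -[leLHS]mulr_natl.
move=> /(ler_wpM2l (ler0n R B)).
have : sumsq a N <= sumsq a (B + N) by apply: sumsq_mono; rewrite leq_addl.
have ed0 : 0 <= (rho - delta) * delta by rewrite mulr_ge0 // ltW.
move=> /(ler_wpM2l ed0).
rewrite sumsqD.
set X := \sum_(k < N) a (B + k)%N ^+ 2.
lra.
Qed.

(** The small-gain theorem for the loop b -> a -> d -> b. Here a is the consensus
    error, d the dual step, b the variation of the primal iterate, and F a
    potential that pays for the d's with the a's. When the product of the gains
    is below 1 the partial sums of a^2 are bounded, and the potential with
    them. *)
Lemma closed_loop_bounded B rho delta gain eta theta a b d F :
  (0 < B)%N -> 0 <= delta -> delta < rho -> 0 < eta -> 0 <= theta ->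
  (forall k, 0 <= a k) -> (forall k, 0 <= b k) -> (forall k, 0 <= F k) ->
  (forall k, rho * a (k + B)%N <= delta * a k + \sum_(t < B) b (k + t.+1)%N) ->
  (forall k, b k.+2 <= gain * d k) ->
  (forall k, F k.+1 + eta * d k ^+ 2 <= F k + theta * a k.+1 ^+ 2) ->
  B%:R ^+ 2 * gain ^+ 2 * theta < eta * (rho - delta) ^+ 2 ->
  exists C, forall k, F k <= C.
Proof.
move=> B0 d0 dr eta0 theta0 a0 b0 F0 ha hb hF small.
have descent N : F N + eta * sumsq d N <= F 0%N + theta * sumsq a N.+1.
  have shift : F N + eta * sumsq d N <=
      F 0%N + theta * \sum_(k < N) a k.+1 ^+ 2.
    elim: N => [|N IH]; first by rewrite /sumsq !big_ord0 !mulr0.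
    by rewrite sumsqS big_ord_recr /=; have := hF N; lra.
  apply: le_trans shift _; rewrite lerD2l ler_wpM2l //.
  by rewrite /sumsq big_ord_recl lerDr sqr_ge0.
have loopb N : sumsq b N.+1 <= sumsq b 2 + gain ^+ 2 * sumsq d N.
  apply: (@le_trans _ _ (sumsq b (2 + N))); first exact: sumsq_mono.
  rewrite sumsqD lerD2l /sumsq mulr_sumr; apply: ler_sum => k _.
  rewrite -exprMn ler_pXn2r ?nnegrE ?b0 //; first exact: hb.
  exact: le_trans (b0 _) (hb k).
pose gap := eta * (rho - delta) ^+ 2 - B%:R ^+ 2 * gain ^+ 2 * theta.
have gap0 : 0 < gap by rewrite subr_gt0.
pose C0 := eta * ((rho - delta) * rho * sumsq a B + B%:R ^+ 2 * sumsq b 2)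
  + B%:R ^+ 2 * gain ^+ 2 * F 0%N.
have boundA N : sumsq a (B + N) <= C0 / gap.
  rewrite ler_pdivlMr // mulrC /gap /C0.
  have := window_gain B0 d0 dr a0 ha N.
  have [M ->] : exists M, (B + N = M.+1)%N.
    by exists (B + N).-1; rewrite prednK // addn_gt0 B0.
  move=> h1; have := descent M; have := loopb M; have := F0 M.
  set SA := sumsq a M.+1 in h1 *; set SB := sumsq b M.+1 in h1 *.
  set SD := sumsq d M => FM h2 h3.
  have h3' : eta * SD <= F 0%N + theta * SA by lra.
  have := ler_wpM2l (ltW eta0) h1.
  have BB : 0 <= B%:R ^+ 2 :> R by rewrite sqr_ge0.
  have := ler_wpM2l (ltW eta0) (ler_wpM2l BB h2).
  have BG : 0 <= B%:R ^+ 2 * gain ^+ 2 by rewrite mulr_ge0 ?sqr_ge0.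
  have := ler_wpM2l BG h3'.
  lra.
exists (F 0%N + theta * (C0 / gap)) => N.
have := descent N; have := sumsq_ge0 d N => /(mulr_ge0 (ltW eta0)).
have : sumsq a N.+1 <= C0 / gap.
  by apply: le_trans (boundA N.+1); apply: sumsq_mono; rewrite leq_addl.
move=> /(ler_wpM2l theta0); lra.
Qed.

End SmallGain.

(** * The convergence rate *)

(** The rate lambda satisfies
    lambda ^ B = max (sqrt (1 - c / (2 L))) (delta + gam): the threshold alpha is
    the step at which the two are equal. Both lower bounds are needed, the first
    by the optimization dynamics, the second by the mixing dynamics. *)
Section Rate.
Context {R : realType}.
Context {mu L c delta : R} {B : nat}.
Context (mu_gt0 : 0 < mu) (mu_le_L : mu <= L) (B_gt0 : (0 < B)%N).
Context (delta_ge0 : 0 <= delta) (delta_lt1 : delta < 1).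
Context (c_gt0 : 0 < c) (c_le : c <= step_max mu L B delta).

Let s := Num.sqrt (mu / L).
Let gam := Num.sqrt (4 * c * B%:R ^+ 2 / (mu * s)).

Let L_gt0 : 0 < L. Proof. exact: lt_le_trans mu_le_L. Qed.
Let s_gt0 : 0 < s. Proof. by rewrite sqrtr_gt0 divr_gt0. Qed.
Let s_le1 : s <= 1.
Proof. by rewrite -sqrtr1 ler_wsqrtr // ler_pdivrMr // mul1r. Qed.

Lemma gamma_sqr : gam ^+ 2 = 4 * c * B%:R ^+ 2 / (mu * s).
Proof. by rewrite sqr_sqrtr // divr_ge0 ?mulr_ge0 ?sqr_ge0 // ltW. Qed.

Lemma gamma_gt0 : 0 < gam.
Proof.
by rewrite sqrtr_gt0 divr_gt0 ?mulr_gt0 ?exprn_gt0 ?ltr0n.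
Qed.

(** Equality holds at the largest admissible step. *)
Lemma gamma_le : delta + gam <= 1.
Proof.
rewrite -lerBrDl -(ler_pXn2r (n := 2)) ?nnegrE ?subr_ge0 ?(ltW gamma_gt0)
  ?(ltW delta_lt1) //.
rewrite gamma_sqr ler_pdivrMr ?mulr_gt0 // mulrC.
have B2 : 0 < 4 * B%:R ^+ 2 :> R by rewrite mulr_gt0 ?exprn_gt0 ?ltr0n.
have := c_le; rewrite /step_max -/s -(ler_pM2l B2).
have -> : 4 * B%:R ^+ 2 * (mu * s / (4 * B%:R ^+ 2) * (1 - delta) ^+ 2) =
  mu * s * (1 - delta) ^+ 2.
  by field; rewrite gt_eqF // ltr0n.
lra.
Qed.

Lemma step_le : c <= mu / 4.
Proof.
have g1 : gam ^+ 2 <= 1.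
  rewrite expr_le1 ?(ltW gamma_gt0) //.
  have := gamma_le; have := delta_ge0; lra.
move: g1; rewrite gamma_sqr ler_pdivrMr ?mulr_gt0 // mul1r.
have : c <= c * B%:R ^+ 2 by rewrite ler_peMr ?exprn_ege1 ?ler1n // ltW.
have : mu * s <= mu by rewrite ler_piMr // ltW.
lra.
Qed.

Lemma contraction_ge : 7 / 8 <= 1 - c / (2 * L).
Proof.
have : c / (2 * L) <= 1 / 8.
  by rewrite ler_pdivrMr ?mulr_gt0 //; have := mu_le_L; have := step_le; lra.
lra.
Qed.

(** With q = 2 sqrt kappa mu and c = q t^2, the inequality on the right is
    t^2 (K + 8 B^2) + 2 sqrt 8 delta B t <= 1 - delta^2, where K = kappa^(3/2),
    and the threshold is q times the square of the positive root of this
    quadratic. *)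
Lemma threshold_crossing :
  (c <= step_threshold mu L B delta) =
  ((delta + gam) ^+ 2 <= 1 - c / (2 * L)).
Proof.
set kappa := mu / L.
have kE : s ^+ 2 = kappa by rewrite sqr_sqrtr // divr_ge0 // ltW.
pose K := kappa * s.
have KE : kappa `^ (3 / 2) = K.
  rewrite (_ : 3 / 2 = 1 + 2^-1); last by field.
  rewrite powRD; last by apply/implyP => _; rewrite gt_eqF // divr_gt0.
  by rewrite powRr1 ?divr_ge0 ?ltW // powR12_sqrt // divr_ge0 // ltW.
have K0 : 0 < K by rewrite mulr_gt0 // divr_gt0.
have B2 : 0 < 8 * B%:R ^+ 2 :> R by rewrite mulr_gt0 ?exprn_gt0 ?ltr0n.
pose D := K + 8 * B%:R ^+ 2.
have D0 : 0 < D by rewrite addr_gt0.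
pose h := Num.sqrt 8 * B%:R : R.
have h0 : 0 < h by rewrite mulr_gt0 ?sqrtr_gt0 // ltr0n.
have h2 : h ^+ 2 = 8 * B%:R ^+ 2 by rewrite exprMn sqr_sqrtr.
pose N := Num.sqrt ((1 - delta ^+ 2) * K + 8 * B%:R ^+ 2).
have d21 : delta ^+ 2 <= 1 by rewrite expr_le1 // ltW.
have rad0 : 0 <= (1 - delta ^+ 2) * K.
  by rewrite mulr_ge0 ?(ltW K0) // subr_ge0.
have N2 : N ^+ 2 = (1 - delta ^+ 2) * K + 8 * B%:R ^+ 2.
  by rewrite sqr_sqrtr // addr_ge0 // ltW.
have N0 : 0 <= N by exact: sqrtr_ge0.
have hN : delta * h <= N.
  rewrite -(ler_pXn2r (n := 2)) ?nnegrE ?mulr_ge0 ?(ltW h0) //.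
  by rewrite N2 exprMn h2; nra.
pose q := 2 * s * mu.
have q0 : 0 < q by rewrite !mulr_gt0.
have [t [t0 gE cE]] : exists t, [/\ 0 < t, gam = t * h & c = q * t ^+ 2].
  exists (gam / h); split; first by rewrite divr_gt0 // gamma_gt0.
    by rewrite divfK // gt_eqF.
  rewrite expr_div_n gamma_sqr h2 /q; field.
  by rewrite !gt_eqF // ltr0n.
have -> : step_threshold mu L B delta = q * ((N - delta * h) / D) ^+ 2.
  rewrite /step_threshold -/kappa KE -/N -/D -/s /q /h.
  by congr (_ * (_ / _) ^+ 2); ring.
have cL : c / (2 * L) = t ^+ 2 * K.
  rewrite cE /q /K /kappa; field; exact: lt0r_neq0.
rewrite {1}cE ler_pM2l // ler_pXn2r ?nnegrE ?divr_ge0 ?subr_ge0 ?(ltW t0) ?(ltW D0) //.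
rewrite ler_pdivlMr // lerBrDr.
rewrite -(ler_pXn2r (n := 2)) ?nnegrE ?addr_ge0 ?mulr_ge0 ?(ltW t0) ?(ltW D0)
  ?(ltW h0) //.
rewrite N2 -h2 cL gE -[LHS]subr_ge0 -[RHS]subr_ge0.
have -> : (1 - delta ^+ 2) * K + h ^+ 2 - (t * D + delta * h) ^+ 2 =
   D * (1 - t ^+ 2 * K - (delta + t * h) ^+ 2).
  by rewrite /D -h2; ring.
by rewrite pmulr_rge0.
Qed.

Lemma panda_rateP (lambda := panda_rate mu L B delta c) :
  [/\ 0 < lambda, lambda <= 1, 1 - c / (2 * L) <= lambda ^+ 2,
      delta < lambda ^+ B
    & 4 * c * B%:R ^+ 2 <= (lambda ^+ B - delta) ^+ 2 * (mu * s)].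
Proof.
have root (x : R) k : 0 < x -> x <= 1 -> (0 < k)%N ->
    [/\ 0 < x `^ k%:R^-1, x `^ k%:R^-1 <= 1 & (x `^ k%:R^-1) ^+ k = x].
  move=> x0 x1 k0; split; first exact: powR_gt0.
    by rewrite -[leRHS](powRr0 x) ger_powR ?x0 // invr_ge0.
  rewrite -powR_mulrn ?powR_ge0 // -powRrM mulVf ?powRr1 ?ltW //.
  by rewrite pnatr_eq0 -lt0n.
have q0 := contraction_ge.
have q1 : 1 - c / (2 * L) <= 1 by rewrite gerBl divr_ge0 ?mulr_ge0 // ltW.
have g0 := gamma_gt0.
have [l0 l1 lB2 lBg] : [/\ 0 < lambda, lambda <= 1,
    1 - c / (2 * L) <= (lambda ^+ B) ^+ 2 & delta + gam <= lambda ^+ B].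
  rewrite /lambda /panda_rate -/s -/gam threshold_crossing.
  have [cross|cross] := leP ((delta + gam) ^+ 2) (1 - c / (2 * L)).
    have [||e0 e1 eE] := @root (1 - c / (2 * L)) (2 * B)%N _ q1.
    - lra.
    - by rewrite muln_gt0.
    split => //; first by rewrite -exprM (mulnC B 2) eE.
    rewrite -(ler_pXn2r (n := 2)) ?nnegrE ?exprn_ge0 ?(ltW e0) //.
      by rewrite -exprM (mulnC B 2) eE.
    by rewrite addr_ge0 // ltW.
  have [||e0 e1 eE] := @root (delta + gam) B _ gamma_le => //.
    by rewrite ltr_wpDl.
  by split => //; rewrite eE // ltW.
split => //.
- apply: (le_trans lB2); rewrite ler_pXn2r ?nnegrE ?exprn_ge0 ?(ltW l0) //.
  by rewrite -{2}(expr1 lambda) ler_wiXn2l // ltW.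
- by apply: lt_le_trans lBg; rewrite ltrDl.
- have g2 : gam ^+ 2 <= (lambda ^+ B - delta) ^+ 2.
    by rewrite ler_pXn2r ?nnegrE ?subr_ge0 ?(ltW g0) //; lra.
  by move: g2; rewrite gamma_sqr ler_pdivrMr ?mulr_gt0.
Qed.

(** From the bound on lambda ^ B - delta the claim reduces to
    c sqrt kappa < 3 mu lambda^2, which c <= mu / 4 and lambda^2 >= 7 / 8 satisfy
    with a large margin, so that coarse estimates of both gains
    suffice. *)
Lemma loop_gain_lt1 (lambda := panda_rate mu L B delta c) :
  B%:R ^+ 2 * (mu * lambda ^+ 2)^-1 ^+ 2 * (c / 2 * lambda ^+ 2)
    < 3 / (8 * c) * (lambda ^+ B - delta) ^+ 2.
Proof.
have [l0 l1 l2 _ lB] := panda_rateP; rewrite -/lambda in l0 l1 l2 lB.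
have B2 : 0 < B%:R ^+ 2 :> R by rewrite exprn_gt0 // ltr0n.
apply: (@lt_le_trans _ _ (3 * B%:R ^+ 2 / (2 * (mu * s)))); last first.
  rewrite ler_pdivrMr ?mulr_gt0 //.
  have -> : 3 / (8 * c) * (lambda ^+ B - delta) ^+ 2 * (2 * (mu * s)) =
    3 / (4 * c) * ((lambda ^+ B - delta) ^+ 2 * (mu * s)).
    by field; rewrite gt_eqF.
  apply: le_trans (ler_wpM2l _ lB); last by rewrite divr_ge0 // mulr_ge0 // ltW.
  by rewrite le_eqVlt; apply/orP; left; apply/eqP; field; rewrite gt_eqF.
have -> : B%:R ^+ 2 * (mu * lambda ^+ 2)^-1 ^+ 2 * (c / 2 * lambda ^+ 2) =
  c * B%:R ^+ 2 / (2 * mu ^+ 2 * lambda ^+ 2).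
  by field; rewrite !gt_eqF.
rewrite ltr_pdivrMr ?mulr_gt0 ?exprn_gt0 //.
have -> : 3 * B%:R ^+ 2 / (2 * (mu * s)) * (2 * mu ^+ 2 * lambda ^+ 2) =
   3 * B%:R ^+ 2 * mu * lambda ^+ 2 / s.
  by field; rewrite !gt_eqF.
rewrite ltr_pdivlMr //.
rewrite [ltRHS](_ : _ = B%:R ^+ 2 * (3 * mu * lambda ^+ 2)); last by ring.
rewrite [ltLHS](_ : _ = B%:R ^+ 2 * (c * s)); last by ring.
rewrite ltr_pM2l //.
have := step_le; have := contraction_ge; have := s_le1; have := s_gt0.
move: l2; have := c_gt0; have := mu_gt0.
set l := lambda ^+ 2 => m0 c0 h1 h2 h3 h4 h5.
have h6 : c * s <= c by rewrite ler_piMr // ltW.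
have h7 : mu * (7 / 8) <= mu * l by rewrite ler_pM2l //; lra.
lra.
Qed.

End Rate.

(** * Mixing block vectors *)

Section Blocks.
Context {R : realType} {n p : nat}.
Implicit Types (x y : 'cV[R]_(n * p)) (A : 'M[R]_n).

(** A vector of size n * p is an n by p matrix whose i-th row is the block of
    agent i; act is left multiplication by A on that matrix, and the slices below
    are its columns. *)
Definition act A x : 'cV[R]_(n * p) := (A *t (1%:M : 'M[R]_p)) *m x.

Definition slice x (j : 'I_p) : 'cV[R]_n := \col_i x (mxtens_index (i, j)) 0.

Lemma sum_mxtens (F : 'I_(n * p) -> R) :
  \sum_k F k = \sum_j \sum_i F (mxtens_index (i, j)).
Proof.
rewrite exchange_big pair_bigA /= (reindex (@mxtens_index n p)) /=.
  by apply: eq_bigr => -[].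
exists (@mxtens_unindex n p) => k _; first exact: mxtens_indexK.
exact: mxtens_unindexK.
Qed.

Lemma slice_inj x y : (forall j, slice x j = slice y j) -> x = y.
Proof.
move=> h; apply/colP => k; case: (mxtens_indexP k) => i j.
by have /colP /(_ i) := h j; rewrite !mxE.
Qed.

Lemma slice_act A x j : slice (act A x) j = A *m slice x j.
Proof.
apply/colP => i; rewrite !mxE sum_mxtens (bigD1 j) //= [X in _ + X]big1 => [|k kj].
  rewrite addr0; apply: eq_bigr => l _.
  by rewrite tensmxE mxE eqxx mulr1 mxE.
by apply: big1 => l _; rewrite tensmxE mxE eq_sym (negPf kj) mulr0 mul0r.
Qed.

Lemma dotv_slice x y : dotv x y = \sum_j dotv (slice x j) (slice y j).
Proof.
rewrite dotvE sum_mxtens; apply: eq_bigr => j _.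
by rewrite dotvE; apply: eq_bigr => i _; rewrite !mxE.
Qed.

Lemma act1 x : act 1%:M x = x.
Proof. by apply: slice_inj => j; rewrite slice_act mul1mx. Qed.

Lemma actM A C x : act (A *m C) x = act A (act C x).
Proof. by apply: slice_inj => j; rewrite !slice_act mulmxA. Qed.

Lemma act_subl A C x : act (A - C) x = act A x - act C x.
Proof.
apply: slice_inj => j; rewrite slice_act mulmxBl -!slice_act.
by apply/colP => i; rewrite !mxE.
Qed.

Lemma actD A x y : act A (x + y) = act A x + act A y.
Proof. exact: mulmxDr. Qed.

Lemma actB A x y : act A (x - y) = act A x - act A y.
Proof. exact: mulmxBr. Qed.

Lemma actZ A (a : R) x : act A (a *: x) = a *: act A x.
Proof. by rewrite /act -scalemxAr. Qed.

Lemma dotv_act A x y : dotv (act A x) y = dotv x (act A^T y).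
Proof.
by rewrite /dotv /act trmx_mul trmx_tens trmx1 mulmxA.
Qed.

Lemma enorm_act_le A x : nonexpansive A -> enorm (act A x) <= enorm x.
Proof.
move=> hA; apply: enorm_le_dotv; rewrite !dotv_slice.
by apply: ler_sum => j _; rewrite slice_act.
Qed.

Context (n_gt0 : (0 < n)%N).

Lemma act_window_contract (W : nat -> 'M[R]_n) b k x :
  (forall k, doubly_stochastic (W k)) -> (b.-1 <= k)%N -> act avg_mx x = 0 ->
  enorm (act (window W b k) x) <= joint_spectrum W b * enorm x.
Proof.
move=> Wds bk x0; have d0 := @joint_spectrum_ge0 R n n_gt0 W Wds b.
rewrite enorm_leP ?mulr_ge0 ?enorm_ge0 // exprMn enorm_sqr !dotv_slice mulr_sumr.
apply: ler_sum => j _; rewrite slice_act; apply: window_contract => //.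
by rewrite -slice_act x0; apply/colP => i; rewrite !mxE.
Qed.

(** * Consensus vectors and zero-mean vectors *)

Definition center x := act (1%:M - avg_mx) x.

Lemma centerE x : center x = x - act avg_mx x.
Proof. by rewrite /center act_subl act1. Qed.

Lemma centerD x y : center (x + y) = center x + center y.
Proof. exact: actD. Qed.

Lemma centerB x y : center (x - y) = center x - center y.
Proof. exact: actB. Qed.

Lemma avg_center x : act avg_mx (center x) = 0.
Proof. by rewrite centerE actB -actM avg_idem // subrr. Qed.

Lemma center_avg x : center (act avg_mx x) = 0.
Proof. by rewrite centerE -actM avg_idem // subrr. Qed.

Lemma zero_mean_center y : zero_mean y -> center y = y.
Proof. by move=> y0; rewrite centerE (_ : act _ _ = 0) ?subr0. Qed.

Lemma consensusE x : consensus x -> act avg_mx x = x.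
Proof.
move=> x0; have : center x = 0 by [].
by rewrite centerE => /eqP; rewrite subr_eq0 => /eqP.
Qed.

Lemma dotv_zero_mean y x : zero_mean y -> dotv y x = dotv y (center x).
Proof.
move=> y0; rewrite centerE dotvDr dotvNr -trmx_avg -dotv_act.
by rewrite (_ : act _ _ = 0) ?dotv0l ?subr0.
Qed.

Lemma dotv_consensus y x : zero_mean y -> consensus x -> dotv y x = 0.
Proof.
by move=> y0 x0; rewrite dotv_zero_mean // (_ : center x = 0) ?dotv0r.
Qed.

Lemma orthogonal_zero_mean y :
  (forall x, consensus x -> dotv y x = 0) -> zero_mean y.
Proof.
move=> h; apply: (@dotv_eq0 R _ (act avg_mx y)).
rewrite dotv_act trmx_avg -actM avg_idem // h //; exact: center_avg.
Qed.

Definition replicate (v : 'rV[R]_p) : 'cV[R]_(n * p) :=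
  \col_k v 0 (mxtens_unindex k).2.

Lemma replicate_coord v i j : replicate v (mxtens_index (i, j)) 0 = v 0 j.
Proof. by rewrite mxE mxtens_indexK. Qed.

Lemma consensus_replicate v : consensus (replicate v).
Proof.
apply: slice_inj => j; rewrite -/(act _ _) slice_act.
have -> : slice (replicate v) j = v 0 j *: ones.
  by apply/colP => i; rewrite mxE replicate_coord !mxE mulr1.
rewrite -scalemxAr mulmxBl mul1mx.
have [_ -> _] := @avg_doubly_stochastic R n n_gt0.
by rewrite subrr scaler0; apply/colP => i; rewrite !mxE.
Qed.

Lemma replicateP x : consensus x -> exists v, x = replicate v.
Proof.
move=> /consensusE cx; pose i0 := Ordinal n_gt0.
exists (\row_j x (mxtens_index (i0, j)) 0).
apply/colP => k; case: (mxtens_indexP k) => i j.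
rewrite replicate_coord mxE -cx.
have /colP s := slice_act avg_mx x j.
have := s i; have := s i0; rewrite !mxE => -> ->.
by apply: eq_bigr => l _; rewrite !mxE !big_ord1 !mxE.
Qed.

Lemma continuous_replicate : continuous replicate.
Proof.
move=> v S /= /nbhs_ballP[e e0 eS]; apply/nbhs_ballP; exists e => //= w [_ vw].
by apply: eS; split=> // k l; rewrite !mxE; exact: vw.
Qed.

Lemma replicate_norm v : `|v| <= enorm (replicate v).
Proof.
apply: norm_rV_le => [|j]; first exact: enorm_ge0.
by rewrite -(replicate_coord v (Ordinal n_gt0) j) coord_le_enorm.
Qed.

(** The consensus vectors are parametrized by a single block, and f restricted to
    them is continuous with bounded sublevel sets by strong convexity. *)
Lemma consensus_argmin (f : 'cV[R]_(n * p) -> R) (g : 'cV[R]_(n * p) -> 'cV[R]_(n * p))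
    (mu : R) : 0 < mu -> continuous f ->
  (forall u v, f v + dotv (g v) (u - v) + mu / 2 * enorm (u - v) ^+ 2 <= f u) ->
  exists x, is_argmin f consensus x.
Proof.
move=> mu0 fcont fconv.
pose h v := f (replicate v).
have hcont : continuous h.
  by move=> v; apply: continuous_comp; [exact: continuous_replicate|exact: fcont].
pose S := [set v | h v <= f 0].
have r0 : replicate 0 = 0 by apply/colP => k; rewrite !mxE.
have S0 : S 0 by rewrite /S /= /h r0.
have [||v] := @EVT_min_rV R p h S (ex_intro _ 0 S0).
- apply: bounded_closed_compact.
    exists (2 / mu * enorm (g 0)); split=> [|a ea v Sv]; first exact: num_real.
    apply: le_trans (replicate_norm v) (ltW (le_lt_trans _ ea)).
    have := fconv (replicate v) 0; rewrite subr0 => hv.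
    have := cauchy_schwarz (- g 0) (replicate v).
    have -> : enorm (- g 0) = enorm (g 0).
      by rewrite -scaleN1r enormZ normrN1 mul1r.
    rewrite dotvNl => cs.
    have Sv' : f (replicate v) <= f 0 by [].
    have [e0|e0] := leP (enorm (replicate v)) 0.
      by apply: le_trans e0 _; rewrite mulr_ge0 ?enorm_ge0 ?divr_ge0 // ltW.
    rewrite mulrAC ler_pdivlMr // -(ler_pM2r e0).
    move: hv cs Sv'; set N := enorm _; set G := enorm _; nra.
  by move/continuous_closedP: hcont => /(_ _ (@closed_le R (f 0))).
- exact: continuous_subspaceT.
rewrite inE => Sv vmin; exists (replicate v); split.
  exact: consensus_replicate.
move=> _ /replicateP[w ->].
have [Sw|/ltW Sw] := leP (h w) (f 0); first by apply: vmin; rewrite inE.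
exact: le_trans Sv Sw.
Qed.

End Blocks.

(** * The primal and dual optimal points *)

Section Optima.
Context {R : realType} {n p : nat}.
Context {f : 'cV[R]_(n * p) -> R} {g : 'cV[R]_(n * p) -> 'cV[R]_(n * p)}.
Context {mu L : R} (n_gt0 : (0 < n)%N) (mu_gt0 : 0 < mu) (L_gt0 : 0 < L).
Context (f_convex : forall u v,
  f v + dotv (g v) (u - v) + mu / 2 * enorm (u - v) ^+ 2 <= f u).
Context (g_lip : forall u v, enorm (g u - g v) <= L * enorm (u - v)).
Context {xs : 'cV[R]_(n * p)} (xs_min : is_argmin f consensus xs).

Let xs_consensus : consensus xs. Proof. by case: xs_min. Qed.

Lemma consensus_line (x v : 'cV[R]_(n * p)) (t : R) :
  consensus x -> consensus v -> consensus (x + t *: v).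
Proof.
move=> x0 v0; rewrite /consensus /= -/(act _ _) actD actZ.
by rewrite (_ : act _ x = 0) // (_ : act _ v = 0) // scaler0 addr0.
Qed.

(** At a minimum over a subspace the gradient is orthogonal to that subspace, and
    the orthogonal complement of the consensus vectors is the set of zero-mean
    ones. *)
Lemma grad_optimum_zero_mean : zero_mean (g xs).
Proof.
have ge0 v : consensus v -> 0 <= dotv (g xs) v.
  move=> v0; rewrite -[leLHS](dotv0l v).
  apply: (argmin_first_order mu_gt0 f_convex g_lip L_gt0) => t _.
  rewrite !dotv0l !subr0; case: xs_min => _; apply.
  exact: consensus_line.
apply: orthogonal_zero_mean => // v v0; apply/eqP; rewrite eq_le ge0 // andbT.
rewrite -oppr_ge0 -dotvNr ge0 // -[- v]add0r -scaleN1r.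
by apply: consensus_line => //; rewrite /consensus /= mulmx0.
Qed.

Lemma dotv_grad_optimum : dotv (g xs) xs = 0.
Proof. exact: dotv_consensus grad_optimum_zero_mean xs_consensus. Qed.

Lemma primal_optimum_unique : unique (is_argmin f consensus) xs.
Proof.
split=> // x [x0 xmin].
have := bregman_ge_primal f_convex x xs; rewrite /bregman dotvDr dotvNr.
rewrite !(dotv_consensus grad_optimum_zero_mean) // subr0 subr0 => h.
have xE : f x <= f xs by exact: xmin.
apply/esym/eqP; rewrite -subr_eq0; apply/eqP/dotv_eq0.
have m2 : 0 < mu / 2 by rewrite divr_gt0.
by rewrite -(ler_pM2l m2) mulr0 (le_trans h) // subr_le0.
Qed.

Lemma conjugate_ge (y : 'cV[R]_(n * p)) : zero_mean y -> ((- f xs)%:E <= conjugate f y)%E.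
Proof.
move=> y0; apply: ereal_sup_ubound; exists xs => //.
by rewrite (dotv_consensus y0) // sub0r.
Qed.

Lemma conjugate_optimum : (conjugate f (g xs) <= (- f xs)%:E)%E.
Proof.
apply: ge_ereal_sup => _ [u _ <-]; rewrite lee_fin.
have := bregman_ge0 mu_gt0 f_convex u xs; rewrite /bregman dotvDr dotvNr.
by rewrite dotv_grad_optimum; lra.
Qed.

(** Zero-mean y are orthogonal to xs, so the value of the conjugate at y is at
    least - f xs; it equals - f xs exactly when xs minimizes f - <y, .>, that is,
    when y is the gradient at xs. *)
Lemma dual_optimum_unique :
  unique (is_argmin (conjugate f) zero_mean) (g xs).
Proof.
split.
  split=> [|y y0]; first exact: grad_optimum_zero_mean.
  exact: le_trans conjugate_optimum (conjugate_ge y0).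
move=> y [y0 ymin]; apply/esym.
apply: (argmin_grad mu_gt0 f_convex g_lip L_gt0) => u.
rewrite (dotv_consensus y0) // subr0.
have : ((dotv y u - f u)%:E <= (- f xs)%:E)%E.
  apply: le_trans (le_trans (ymin _ grad_optimum_zero_mean) conjugate_optimum).
  by apply: ereal_sup_ubound; exists u.
by rewrite lee_fin; lra.
Qed.

(** * The dynamics of the algorithm *)

Context {W : nat -> 'M[R]_n} (W_ds : forall k, doubly_stochastic (W k)).
Context {c : R} (c_gt0 : 0 < c) (c_le : c <= mu / 4).
Context {x y z : nat -> 'cV[R]_(n * p)} (run : panda f W c x y z).

Lemma panda_grad k : y k = g (x k.+1).
Proof.
case: run => _ _ _ /(_ k) [[_ xmin] _ _].
by apply: (argmin_grad mu_gt0 f_convex g_lip L_gt0) => u; exact: xmin.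
Qed.

Lemma panda_z k : z k.+1 = act (W k) (z k) + (x k.+1 - x k).
Proof. by case: run => _ _ _ /(_ k) [_ -> _]; rewrite addrA. Qed.

Lemma panda_y k : y k.+1 - y k = - (c *: (x k.+1 - z k.+1)).
Proof. by case: run => _ _ _ /(_ k) [_ _ ->]; rewrite addrAC subrr add0r. Qed.

Lemma panda_x k : x k.+1 = z k.+1 - c^-1 *: (y k.+1 - y k).
Proof.
rewrite panda_y scalerN scalerA mulVf ?gt_eqF // scale1r opprK addrC.
by rewrite subrK.
Qed.

Lemma panda_mean k : act avg_mx (z k) = act avg_mx (x k).
Proof.
elim: k => [|k IH]; first by case: run => -> ->.
by rewrite panda_z actD -actM avg_mul // IH actB addrC subrK.
Qed.

Lemma panda_dy_zero_mean k : zero_mean (y k.+1 - y k).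
Proof.
rewrite /zero_mean /= -/(act _ _) panda_y -scaleN1r !actZ actB panda_mean.
by rewrite subrr !scaler0.
Qed.

Lemma panda_zero_mean k : zero_mean (y k).
Proof.
elim: k => [|k IH]; first by case: run.
rewrite -(subrK (y k) (y k.+1)) /zero_mean /= -/(act _ _) actD.
have -> : act avg_mx (y k.+1 - y k) = 0 by exact: panda_dy_zero_mean.
by rewrite add0r.
Qed.

Lemma center_act_ds (A : 'M[R]_n) (u : 'cV[R]_(n * p)) : doubly_stochastic A ->
  center (act A u) = act A (center u).
Proof.
by move=> hA; rewrite !centerE actB -!actM avg_mul // mul_avg.
Qed.

(** Each step multiplies the previous discrepancy by a nonexpansive matrix and
    adds one more centered variation of x, which centering does not
    enlarge. *)
Lemma center_z_unroll k m :
  enorm (center (z (k + m)%N) - act (window W m (k + m).-1) (center (z k)))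
    <= \sum_(t < m) enorm (x (k + t.+1)%N - x (k + t)%N).
Proof.
elim: m => [|m IH].
  by rewrite window0 act1 addn0 subrr enorm0 big_ord0.
rewrite big_ord_recr /= addnS windowS actM panda_z centerD.
rewrite center_act_ds // addrAC -actB.
apply: le_trans (enormD _ _) (lerD _ _).
  apply: le_trans (enorm_act_le _ _) IH.
  exact: doubly_stochastic_nonexpansive.
exact/enorm_act_le/center_nonexpansive.
Qed.

Lemma center_z_window B k : (0 < B)%N ->
  enorm (center (z (k + B)%N)) <= joint_spectrum W B * enorm (center (z k))
    + \sum_(t < B) enorm (x (k + t.+1)%N - x (k + t)%N).
Proof.
move=> B0; set v := act (window W B (k + B).-1) (center (z k)).
rewrite -(subrK v (center (z (k + B)%N))) addrC.
apply: le_trans (enormD _ _) (lerD _ (center_z_unroll k B)).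
apply: act_window_contract => //; last exact: avg_center.
by rewrite -!subn1 leq_sub2r // leq_addl.
Qed.

(** The dual suboptimality: since y k = g (x k.+1) is orthogonal to xs, it is
    conjugate f (y k) - conjugate f (g xs). *)
Let gap k := bregman f g xs (x k.+1).

Lemma gap_ge0 k : 0 <= gap k.
Proof. exact: (bregman_ge0 mu_gt0 f_convex). Qed.

(** The descent inequality of an inexact dual gradient step. The dual step is
    zero-mean, so only the centered part of the dual gradient x counts, and this
    part is the centered z minus the step divided by c. *)
Lemma gap_descent k :
  gap k.+1 <= gap k + dotv (y k.+1 - y k) (center (z k.+1))
    - (c^-1 - (2 * mu)^-1) * enorm (y k.+1 - y k) ^+ 2.
Proof.
rewrite enorm_sqr.
have bE : gap k.+1 =
    gap k + bregman f g (x k.+1) (x k.+2) + dotv (y k.+1 - y k) (x k.+1).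
  rewrite /gap /bregman -!panda_grad !dotvDr !dotvNr dotvDl dotvNl.
  rewrite !(dotv_consensus (panda_zero_mean _) xs_consensus); ring.
have := bregman_le_dual mu_gt0 f_convex (x k.+1) (x k.+2).
rewrite -!panda_grad dotv_subC => hb.
have dx : dotv (y k.+1 - y k) (x k.+1) = dotv (y k.+1 - y k) (center (z k.+1))
    - c^-1 * dotv (y k.+1 - y k) (y k.+1 - y k).
  by rewrite -(dotv_zero_mean _ (panda_dy_zero_mean k)) panda_x dotvDr dotvNr dotvZr.
rewrite bE dx; lra.
Qed.

(** A Polyak-Lojasiewicz inequality for the dual objective on zero-mean
    vectors. *)
Lemma gap_le k : gap k <= L *
  dotv (center (z k.+1) - c^-1 *: (y k.+1 - y k))
       (center (z k.+1) - c^-1 *: (y k.+1 - y k)).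
Proof.
have -> : center (z k.+1) - c^-1 *: (y k.+1 - y k) = center (x k.+1).
  rewrite panda_x centerB [center (c^-1 *: _)]actZ.
  by rewrite -/(center _) (zero_mean_center (panda_dy_zero_mean k)).
have := bregman_sym (f := f) (g := g) xs (x k.+1); rewrite -/(gap k).
have := bregman_ge_dual mu_gt0 f_convex g_lip L_gt0 (x k.+1) xs.
set G := g (x k.+1) - g xs.
have G0 : zero_mean G.
  rewrite /zero_mean /= -/(act _ _) actB -panda_grad.
  have -> : act avg_mx (y k) = 0 by exact: panda_zero_mean.
  have -> : act avg_mx (g xs) = 0 by exact: grad_optimum_zero_mean.
  by rewrite subr0.
have -> : dotv (g xs - g (x k.+1)) (xs - x k.+1) = dotv G (center (x k.+1)).
  rewrite -(opprB (g _)) -(opprB (x _)) dotvNl dotvNr opprK -/G dotvDr dotvNr.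
  by rewrite (dotv_consensus G0 xs_consensus) subr0 -dotv_zero_mean.
have t0 : 0 < (4 * L)^-1 by rewrite invr_gt0 mulr_gt0.
have := young G (center (x k.+1)) t0.
have -> : 4 * (4 * L)^-1 = L^-1 by field; rewrite gt_eqF.
by rewrite invrK; lra.
Qed.

(** The drift (1 - r) gap is at most c / (2 L) gap, hence at most
    c / 2 |center z - step / c|^2 by gap_le. Its cross term cancels the one in
    gap_descent, and half of the 1/c |step|^2 gained in the descent pays for the
    rest. The gain from center z to step / c is thus a constant, independent of
    the condition number: measuring in l2 norms is what makes this possible. *)
Lemma gap_contract k (r : R) : r <= 1 -> 1 - c / (2 * L) <= r ->
  gap k.+1 + 3 / (8 * c) * enorm (y k.+1 - y k) ^+ 2
    <= r * gap k + c / 2 * enorm (center (z k.+1)) ^+ 2.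
Proof.
move=> r1 rc.
have cL : 0 < c / (2 * L) by rewrite divr_gt0 // mulr_gt0.
have drift : (1 - r) * gap k <= c / (2 * L) * gap k.
  by rewrite ler_wpM2r ?gap_ge0 //; lra.
have := ler_wpM2l (ltW cL) (gap_le k); have := gap_descent k.
rewrite !enorm_sqr !dotv_lin.
rewrite (dotvC (y k.+1) (center _)) (dotvC (y k) (center _)) (dotvC (y k) (y k.+1)).
set zz := dotv (center _) (center _); set u := dotv (center _) (y k.+1).
set v := dotv (center _) (y k).
set a1 := dotv (y k.+1) (y k.+1); set a2 := dotv (y k) (y k).
set a3 := dotv (y k.+1) (y k).
move=> h1 h2.
have {}h2 : c / (2 * L) * gap k <= c / 2 * zz - (u - v)
    + (2 * c)^-1 * (a1 - a3 - (a3 - a2)).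
  apply: le_trans h2 _; rewrite le_eqVlt; apply/orP; left; apply/eqP.
  by field; rewrite !gt_eqF.
have dd0 : 0 <= a1 - a3 - (a3 - a2).
  have := dotv_ge0 (y k.+1 - y k); rewrite !dotv_lin (dotvC (y k) (y k.+1)).
  by rewrite -/a1 -/a2 -/a3; lra.
have coef : 3 / (8 * c) + (2 * c)^-1 <= c^-1 - (2 * mu)^-1.
  rewrite -subr_ge0 (_ : _ - _ = (mu - 4 * c) / (8 * c * mu)); last first.
    by field; rewrite !gt_eqF.
  rewrite divr_ge0 ?mulr_ge0 ?(ltW c_gt0) ?(ltW mu_gt0) //.
  by move: c_le; lra.
have := ler_wpM2r dd0 coef.
move: h1 h2 drift; lra.
Qed.

Lemma dx_le_dy k :
  enorm (x k.+2 - x k.+1) <= mu^-1 * enorm (y k.+1 - y k).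
Proof.
by rewrite ler_pdivlMl // !panda_grad; exact: enorm_le_grad.
Qed.

(** Dividing all sequences by lambda ^ k puts the dynamics in the form of
    closed_loop_bounded. Variations of x are indexed backwards, so that the one
    at time 0 is 0. *)
Lemma gap_rate B (lambda : R) : (0 < B)%N -> 0 < lambda -> lambda <= 1 ->
  1 - c / (2 * L) <= lambda ^+ 2 -> joint_spectrum W B < lambda ^+ B ->
  B%:R ^+ 2 * (mu * lambda ^+ 2)^-1 ^+ 2 * (c / 2 * lambda ^+ 2)
    < 3 / (8 * c) * (lambda ^+ B - joint_spectrum W B) ^+ 2 ->
  exists2 C, 0 <= C & forall k, gap k <= C / lambda ^+ 2 * (lambda ^+ k) ^+ 2.
Proof.
move=> B_gt0 l0 l1 l2 dl small.
have delta_ge0 := joint_spectrum_ge0 n_gt0 W_ds B.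
have l21 : lambda ^+ 2 <= 1 by rewrite expr_le1 // ltW.
have li0 k : 0 < lambda^-1 ^+ k by rewrite exprn_gt0 ?invr_gt0.
pose a k := enorm (center (z k)) * lambda^-1 ^+ k.
pose b k := enorm (x k - x k.-1) * lambda^-1 ^+ k.
pose d k := enorm (y k.+1 - y k) * lambda^-1 ^+ k.
(* gap_contract has lambda ^+ 2 in front of gap k only; with this extra factor
   F k and F k.+1 enter with the same coefficient *)
pose F k := lambda ^+ 2 * gap k * (lambda^-1 ^+ k) ^+ 2.
have F_ge0 k : 0 <= F k.
  by rewrite /F mulr_ge0 ?sqr_ge0 // mulr_ge0 ?sqr_ge0 ?gap_ge0.
have [C FC] : exists C, forall k, F k <= C.
  apply: (@closed_loop_bounded R B (lambda ^+ B) (joint_spectrum W B)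
    (mu * lambda ^+ 2)^-1 (3 / (8 * c)) (c / 2 * lambda ^+ 2) a b d F) => //.
  - by rewrite divr_gt0 // mulr_gt0.
  - by rewrite mulr_ge0 ?sqr_ge0 // divr_ge0 // ltW.
  - by move=> k; rewrite mulr_ge0 ?enorm_ge0 // ltW.
  - by move=> k; rewrite mulr_ge0 ?enorm_ge0 // ltW.
  - move=> k; have := center_z_window k B_gt0.
    move=> /(ler_wpM2r (ltW (li0 k))).
    rewrite mulrDl mulr_suml -mulrA => h.
    have -> : lambda ^+ B * a (k + B)%N =
        enorm (center (z (k + B)%N)) * lambda^-1 ^+ k.
      have lB : lambda^-1 ^+ B * lambda ^+ B = 1.
        by rewrite -exprMn mulVf ?gt_eqF // expr1n.
      by rewrite /a exprD -[RHS]mulr1 -lB; ring.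
    apply: le_trans h _; rewrite lerD2l; apply: ler_sum => t _.
    rewrite /b addnS /= -addnS exprD mulrA.
    rewrite ler_peMr ?mulr_ge0 ?enorm_ge0 ?(ltW (li0 k)) //.
    by rewrite exprn_ege1 // invf_ge1.
  - move=> k; have := dx_le_dy k.
    move=> /(ler_wpM2r (ltW (li0 k.+2))) /le_trans; apply.
    rewrite /d -[k.+2]addn2 exprD exprVn le_eqVlt; apply/orP; left; apply/eqP.
    by field; rewrite !gt_eqF ?exprn_gt0.
  - move=> k; have := gap_contract k l21 l2.
    move=> /(ler_wpM2r (sqr_ge0 (lambda^-1 ^+ k))).
    rewrite /F /a /d (exprS lambda^-1 k) => h.
    apply: le_trans (le_trans h _); rewrite le_eqVlt; apply/orP; left; apply/eqP.
      by field; rewrite !gt_eqF.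
    by field; rewrite gt_eqF.
exists C => [|k]; first exact: le_trans (FC 0%N).
have -> : gap k = F k / lambda ^+ 2 * (lambda ^+ k) ^+ 2.
  by rewrite /F exprVn; field; rewrite !gt_eqF ?exprn_gt0.
by rewrite ler_wpM2r ?sqr_ge0 // ler_wpM2r ?FC // invr_ge0 sqr_ge0.
Qed.

End Optima.

Lemma R_linear_rate_sqr (R : realType) m (s : nat -> 'cV[R]_m) l (lambda K : R) :
  0 <= lambda -> 0 <= K ->
  (forall k, dotv (s k - l) (s k - l) <= K * (lambda ^+ k) ^+ 2) ->
  R_linear_rate s l lambda.
Proof.
move=> l0 K0 h; exists (Num.sqrt K) => k.
by rewrite enorm_leP ?mulr_ge0 ?sqrtr_ge0 ?exprn_ge0 // exprMn sqr_sqrtr.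
Qed.

Theorem theorem1 (R : realType) (n p : nat) (n_gt0 : (0 < n)%N) (p_gt0 : (0 < p)%N)
    (fi : 'I_n -> 'cV[R]_p -> R) (mu L : R) (mu_gt0 : 0 < mu)
    (f_assumption : strongly_convex_smooth mu L (separable_sum fi))
    (E : nat -> rel 'I_n) (W : nat -> 'M[R]_n) (B : nat)
    (W_assumption : mixing E W B)
    (c : R) (c_gt0 : 0 < c)
    (c_le : c <= step_max mu L B (joint_spectrum W B)) :
  let f := separable_sum fi in
  let lambda := panda_rate mu L B (joint_spectrum W B) c in
  exists ystar xstar : 'cV[R]_(n * p),
    [/\ unique (is_argmin (conjugate f) zero_mean) ystar,
        unique (is_argmin f consensus) xstar
      & forall x y z : nat -> 'cV[R]_(n * p), panda f W c x y z ->
          R_linear_rate y ystar lambda /\ R_linear_rate x xstar lambda].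
Proof.
move=> f lambda.
have [_ f_diff f_convex g_lip] := f_assumption.
have [_ _ W_ds B_gt0 delta_lt1] := W_assumption.
have muL : mu <= L.
  by apply: (mu_le_L mu_gt0 f_convex g_lip); rewrite muln_gt0 n_gt0.
have L_gt0 : 0 < L by exact: lt_le_trans muL.
have delta_ge0 := joint_spectrum_ge0 n_gt0 W_ds B.
have [xs xs_min] : exists xs, is_argmin f consensus xs.
  apply: (consensus_argmin n_gt0 mu_gt0 _ f_convex) => u.
  exact: differentiable_continuous.
exists (grad f xs), xs; split.
- exact: (dual_optimum_unique n_gt0 mu_gt0 L_gt0 f_convex g_lip xs_min).
- exact: (primal_optimum_unique n_gt0 mu_gt0 L_gt0 f_convex g_lip xs_min).
move=> x y z run.
have c_le4 := step_le mu_gt0 muL B_gt0 delta_ge0 delta_lt1 c_gt0 c_le.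
have [l0 l1 l2 dl _] :=
  panda_rateP mu_gt0 muL B_gt0 delta_ge0 delta_lt1 c_gt0 c_le.
have small := loop_gain_lt1 mu_gt0 muL B_gt0 delta_ge0 delta_lt1 c_gt0 c_le.
rewrite -/lambda in l0 l1 l2 dl small.
have [C C0 gapC] := gap_rate n_gt0 mu_gt0 L_gt0 f_convex g_lip xs_min W_ds c_gt0
  c_le4 run B_gt0 l0 l1 l2 dl small.
split.
- apply: (@R_linear_rate_sqr _ _ _ _ _ (4 * L * (C / lambda ^+ 2))) => [||k].
  + exact: ltW.
  + by rewrite mulr_ge0 ?divr_ge0 ?sqr_ge0 // mulr_ge0 // ltW.
  have L4 : 0 < 4 * L by rewrite mulr_gt0.
  rewrite -mulrA -ler_pdivrMl // mulrC; apply: le_trans (gapC k).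
  rewrite (panda_grad mu_gt0 L_gt0 f_convex g_lip run) dotv_subC.
  exact: (bregman_ge_dual mu_gt0 f_convex g_lip L_gt0).
(* the initial x does not come from a minimization and gets its own constant *)
- pose K0 := dotv (x 0%N - xs) (x 0%N - xs).
  pose K1 := 2 / mu * (C / lambda ^+ 2 / lambda ^+ 2).
  have K1_ge0 : 0 <= K1 by rewrite !mulr_ge0 ?invr_ge0 ?sqr_ge0 // ltW.
  apply: (@R_linear_rate_sqr _ _ _ _ _ (K0 + K1)) => [||k].
  + exact: ltW.
  + by rewrite addr_ge0 ?dotv_ge0.
  case: k => [|k]; first by rewrite expr0 expr1n mulr1 lerDl.
  apply: (@le_trans _ _ (K1 * (lambda ^+ k.+1) ^+ 2)); last first.
    by rewrite ler_wpM2r ?sqr_ge0 // lerDr dotv_ge0.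
  have m2 : 0 < mu / 2 by rewrite divr_gt0.
  rewrite -(ler_pM2l m2) dotv_subC.
  apply: le_trans (bregman_ge_primal f_convex _ _) (le_trans (gapC k) _).
  rewrite /K1 (exprS lambda k) le_eqVlt; apply/orP; left; apply/eqP.
  by field; rewrite !gt_eqF.
Qed.
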